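(* Let $A:\mathbb{R}^n\rightarrow\mathbb{R}^n$ be a generalized odd oscillatory linear operator. Then the algebraic multiplicity $m(\lambda)$ of any eigenvalue $\lambda$ of $A$ is not greater than $2$. Let $\lambda_1,\ldots,\lambda_n$ be the (complex) eigenvalues of $A$, repeated according to algebraic multiplicity and numbered in order of non-increasing modulus. Then $$\rho(A)=|\lambda_1|>|\lambda_2|\geq|\lambda_3|>|\lambda_4|\geq\ldots,$$ that is, $|\lambda_i|>|\lambda_{i+1}|$ for every odd $i$ with $i+1\le n$. Moreover, $\lambda_1=\rho(A)$ is a simple positive eigenvalue of $A$. If $n$ is even, then $\lambda_n$ is real. For every pair $\lambda_i,\lambda_{i+1}$ with $i=2,4,6,\ldots$ and $i+1\le n$, one has $\arg(\lambda_{i+1})=-\arg(\lambda_i)$ (modulo $2\pi$).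
   Context: $\rho(A)$ denotes the spectral radius of $A$. A set $K\subset\mathbb{R}^N$ is a proper cone if it is a convex cone (for $x,y\in K$, $\alpha\ge 0$ one has $x+y,\alpha x\in K$), pointed ($K\cap(-K)=\{0\}$), closed and solid ($\mathrm{int}(K)\neq\emptyset$). A linear operator $B:\mathbb{R}^N\to\mathbb{R}^N$ is primitive with respect to a proper cone $K$ ($K$-primitive) if $BK\subseteq K$ and the only nonempty subset $S$ of the boundary $\partial(K)$ which is left invariant by $B$ (i.e. $BS\subseteq S$) is $\{0\}$. When $N=1$, the zero operator is not regarded as primitive (so for $N=1$ primitive means multiplication by a positive number). The $j$th exterior power $\wedge^jA$ of a linear operator $A$ on $\mathbb{R}^n$ is the linear operator on $\wedge^j\mathbb{R}^n$ defined by $(\wedge^jA)(x_1\wedge\ldots\wedge x_j)=Ax_1\wedge\ldots\wedge Ax_j$. The space $\wedge^j\mathbb{R}^n$ is identified with $\mathbb{R}^{C_n^j}$, $C_n^j=\frac{n!}{j!(n-j)!}$, via the basis $e_{i_1}\wedge\ldots\wedge e_{i_j}$, $1\le i_1<\ldots<i_j\le n$, where $e_1,\ldots,e_n$ is a basis of $\mathbb{R}^n$. In particular $\wedge^1A=A$, and $\wedge^nA$ is multiplication by $\det A$ on a one-dimensional space. A linear operator $A:\mathbb{R}^n\to\mathbb{R}^n$ is called generalized odd oscillatory if for every odd $j$ with $1\le j\le n$ its $j$th exterior power $\wedge^jA$ is primitive with respect to a proper cone $K_j\subset\mathbb{R}^{C_n^j}$. *)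

(* Defs.v *)
From mathcomp Require Import all_boot all_order all_fingroup all_algebra.
From mathcomp Require Import all_classical all_reals all_analysis.
From mathcomp Require Import complex.

Set Implicit Arguments.
Unset Strict Implicit.
Unset Printing Implicit Defensive.

Import Order.TTheory GRing.Theory Num.Theory.
Import numFieldNormedType.Exports.

Local Open Scope classical_set_scope.
Local Open Scope ring_scope.

(* A linear operator on R^N is given by its matrix B : 'M[R]_N, acting on     *)
(* column vectors by x |-> B *m x.                                            *)

Definition convex_cone (R : realType) (N : nat) (K : set 'cV[R]_N) : Prop :=
  (forall x y, K x -> K y -> K (x + y)) /\
  (forall (a : R) x, 0 <= a -> K x -> K (a *: x)).

Definition proper_cone (R : realType) (N : nat) (K : set 'cV[R]_N) : Prop :=
  [/\ convex_cone K,
      K `&` [set - x | x in K] = [set 0],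
      closed K
    & interior K !=set0].

Definition boundary (T : topologicalType) (K : set T) : set T :=
  closure K `\` interior K.

(* The last clause rules out the zero operator on a line, for which the       *)
(* condition on invariant subsets of the boundary holds trivially.            *)
Definition K_primitive (R : realType) (N : nat) (K : set 'cV[R]_N)
    (B : 'M[R]_N) : Prop :=
  [/\ [set B *m x | x in K] `<=` K,
      (forall S : set 'cV[R]_N, S !=set0 -> S `<=` boundary K ->
         [set B *m x | x in S] `<=` S -> S = [set 0])
    & N = 1%N -> B != 0].

(* multi_index s runs through the strictly increasing j-tuples of elements of *)
(* 'I_n as s runs through 'I_('C(n, j)).  The order in which they are         *)
(* enumerated is immaterial: it only permutes the vectors of a basis.         *)
Definition multi_index (n j : nat) (s : 'I_('C(n, j))) : j.-tuple 'I_n :=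
  enum_val (cast_ord (esym (card_ltn_sorted_tuples j n)) s).

(* The coordinates of x_1 /\ ... /\ x_j, where x_1, ..., x_j are the columns  *)
(* of X, in the basis formed by the e_{i_1} /\ ... /\ e_{i_j} with            *)
(* i_1 < ... < i_j.                                                           *)
Definition wedge (R : realType) (n j : nat) (X : 'M[R]_(n, j)) :
    'cV[R]_('C(n, j)) :=
  \col_s \det (rowsub (tnth (multi_index s)) X).

(* The basis vector e_{i_1} /\ ... /\ e_{i_j} is mapped to                    *)
(* A e_{i_1} /\ ... /\ A e_{i_j}.  Lemma ext_power_wedge below extends this   *)
(* to all decomposable vectors.                                               *)
Definition ext_power (R : realType) (n j : nat) (A : 'M[R]_n) :
    'M[R]_('C(n, j)) :=
  \matrix_(s, t) wedge (A *m colsub (tnth (multi_index t)) 1%:M) s 0.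

Definition generalized_odd_oscillatory (R : realType) (n : nat)
    (A : 'M[R]_n) : Prop :=
  forall j : nat, odd j -> (1 <= j <= n)%N ->
    exists K : set 'cV[R]_('C(n, j)),
      proper_cone K /\ K_primitive K (ext_power j A).

Definition complexify (R : realType) (n : nat) (A : 'M[R]_n) : 'M[R[i]]_n :=
  map_mx (real_complex R) A.

Definition cmod (R : realType) (z : R[i]) : R := Normc.normc z.

Definition spectral_radius (R : realType) (n : nat) (A : 'M[R]_n) : R :=
  sup [set cmod z | z in [set z | eigenvalue (complexify A) z]].

Definition alg_mult (R : realType) (n : nat) (A : 'M[R]_n) (z : R[i]) : nat :=
  mup z (char_poly (complexify A)).

Definition eigenvalue_numbering (R : realType) (n : nat) (A : 'M[R]_n)
    (lam : n.-tuple R[i]) : Prop :=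
  char_poly (complexify A) = \prod_(z <- lam) ('X - z%:P) /\
  sorted (fun z w : R[i] => cmod w <= cmod z) lam.

(* The principal argument, in ]-pi, pi]; the value at 0 is meaningless.       *)
Definition arg (R : realType) (z : R[i]) : R :=
  if 0 <= complex.Im z then acos (complex.Re z / cmod z)
  else - acos (complex.Re z / cmod z).

Definition eq_mod_2pi (R : realType) (a b : R) : Prop :=
  exists k : int, a = b + k%:~R * (2 * pi).

Section ExteriorPower.
Variable R : realType.

Lemma multi_index_sorted n j (s : 'I_('C(n, j))) :
  sorted ltn (map val (multi_index s)).
Proof.
by have := enum_valP (cast_ord (esym (card_ltn_sorted_tuples j n)) s); rewrite inE.
Qed.

Lemma multi_index_inj n j : injective (@multi_index n j).
Proof. by move=> s t /enum_val_inj /cast_ord_inj. Qed.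

Lemma tnth_multi_index_inj n j (s : 'I_('C(n, j))) :
  injective (tnth (multi_index s)).
Proof.
apply/tuple_uniqP; rewrite -(map_inj_uniq val_inj).
exact: (sorted_uniq ltn_trans ltnn (multi_index_sorted s)).
Qed.

Lemma multi_index_eq_mem n j (s t : 'I_('C(n, j))) :
  multi_index s =i multi_index t -> s = t.
Proof.
move=> st; apply/multi_index_inj/val_inj/(inj_map val_inj).
apply: (irr_sorted_eq ltn_trans ltnn); try exact: multi_index_sorted.
by apply: eq_mem_map.
Qed.

Definition perm_index n j (p : 'I_('C(n, j)) * 'S_j) : {ffun 'I_j -> 'I_n} :=
  [ffun i => tnth (multi_index p.1) (p.2 i)].

Lemma perm_index_inj n j : injective (@perm_index n j).
Proof.
move=> [s u] [t v] /ffunP suv.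
have sub (p q : 'I_('C(n, j)) * 'S_j) : (forall i, perm_index p i = perm_index q i) ->
    {subset multi_index p.1 <= multi_index q.1}.
  move=> pq x /tnthP[i ->].
  by have := pq (p.2^-1 i)%g; rewrite !ffunE /= permKV => ->; exact: mem_tnth.
have st : s = t.
  apply: multi_index_eq_mem => x; apply/idP/idP.
  - exact: (sub (s, u) (t, v)).
  - by apply: (sub (t, v) (s, u)) => i; rewrite suv.
rewrite -{}st in suv *; congr pair; apply/permP => i.
by have := suv i; rewrite !ffunE /= => /tnth_multi_index_inj.
Qed.

Lemma perm_index_image n j :
  [set perm_index p | p : 'I_('C(n, j)) * 'S_j]%SET =
  [set f : {ffun 'I_j -> 'I_n} | injectiveb f]%SET.
Proof.
apply/eqP; rewrite eqEcard; apply/andP; split.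
  apply/fintype.subsetP => f /imsetP[[s u] _ ->]; rewrite inE.
  by apply/injectiveP => a b; rewrite !ffunE => /tnth_multi_index_inj /perm_inj.
rewrite card_imset; last exact: perm_index_inj.
rewrite card_inj_ffuns card_prod !card_ord -bin_ffact leq_mul2l.
by apply/orP; right; rewrite -(card_Sn j); apply: eq_leq; exact: eq_card.
Qed.

Lemma Cauchy_Binet n j (M : 'M[R]_(j, n)) (X : 'M[R]_(n, j)) :
  \det (M *m X) = \sum_(s < 'C(n, j))
    \det (colsub (tnth (multi_index s)) M) *
    \det (rowsub (tnth (multi_index s)) X).
Proof.
pose F (f : {ffun 'I_j -> 'I_n}) := \prod_i M i (f i) * \det (rowsub f X).
transitivity (\sum_f F f).
  pose MX s i k := M i k * X k (s i).
  transitivity (\sum_(f : {ffun 'I_j -> 'I_n}) \sum_(s : 'S_j)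
      (-1) ^+ s * \prod_i MX s i (f i)).
    rewrite exchange_big; apply: eq_bigr => /= s _; rewrite -big_distrr /=.
    congr (_ * _); rewrite -(bigA_distr_bigA (MX s)) /=.
    by apply: eq_bigr => i _; rewrite mxE.
  apply: eq_bigr => f _; rewrite /F big_distrr /=; apply: eq_bigr => s _.
  rewrite mulrCA big_split //=; congr (_ * (_ * _)).
  by apply: eq_bigr => i _; rewrite mxE.
rewrite (bigID (fun f : {ffun 'I_j -> 'I_n} => injectiveb f)) /= addrC.
rewrite big1 ?add0r => [|f]; last first.
  case/injectivePn => i1 [i2 Di12 Ef12].
  by rewrite /F (determinant_alternate Di12) ?mulr0 // => k; rewrite !mxE Ef12.
transitivity (\sum_(f in [set f : {ffun 'I_j -> 'I_n} | injectiveb f]%SET) F f).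
  by apply: eq_bigl => f; rewrite inE.
rewrite -perm_index_image big_imset /=; last by move=> ? ? _ _ /perm_index_inj.
rewrite (eq_bigl predT) // -(pair_bigA _ (fun s u => F (perm_index (s, u)))) /=.
apply: eq_bigr => s _; rewrite big_distrl /=; apply: eq_bigr => u _.
rewrite /F.
have -> : rowsub (perm_index (s, u)) X =
    row_perm u (rowsub (tnth (multi_index s)) X).
  by apply/matrixP => a b; rewrite !mxE ffunE.
rewrite row_permE det_mulmx det_perm mulrA [_ * (-1) ^+ _]mulrC; congr (_ * _ * _).
by apply: eq_bigr => i _; rewrite mxE ffunE.
Qed.

Lemma ext_power_wedge n j (A : 'M[R]_n) (X : 'M[R]_(n, j)) :
  ext_power j A *m wedge X = wedge (A *m X).
Proof.
apply/colP => s; rewrite !mxE.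
have -> : rowsub (tnth (multi_index s)) (A *m X) =
    rowsub (tnth (multi_index s)) A *m X.
  by apply/matrixP => a b; rewrite !mxE; apply: eq_bigr => k _; rewrite mxE.
rewrite Cauchy_Binet; apply: eq_bigr => t _; rewrite !mxE.
congr (\det _ * _); apply/matrixP => a b; rewrite !mxE.
rewrite (bigD1 (tnth (multi_index t) b)) //= big1 => [|k kt].
  by rewrite !mxE eqxx mulr1 addr0.
by rewrite !mxE (negPf kt) mulr0.
Qed.

Lemma wedge_basis n j (t : 'I_('C(n, j))) :
  wedge (colsub (tnth (multi_index t)) (1%:M : 'M[R]_n)) = delta_mx t 0.
Proof.
apply/colP => s; rewrite !mxE eqxx andbT.
have [->|st] := eqVneq s t.
  rewrite -[RHS](det1 _ j); congr (\det _); apply/matrixP => a b.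
  by rewrite !mxE (inj_eq (@tnth_multi_index_inj _ _ t)).
have [i sit] : exists i, tnth (multi_index s) i \notin multi_index t.
  apply/existsP; apply: contraR st; rewrite negb_exists => /forallP sub.
  apply/eqP/multi_index_eq_mem.
  have uniq_mi (r : 'I_('C(n, j))) : uniq (multi_index r : seq 'I_n).
    by apply/tuple_uniqP; exact: tnth_multi_index_inj.
  have {}sub : {subset multi_index s <= multi_index t}.
    by move=> x /tnthP[i ->]; have := sub i; rewrite negbK.
  by case: (uniq_min_size (uniq_mi s) sub); rewrite ?size_tuple.
rewrite (expand_det_row _ i) big1 // => k _; rewrite !mxE.
case: eqP => [sk|]; last by rewrite mul0r.
by move: sit; rewrite sk mem_tnth.
Qed.

End ExteriorPower.

Lemma argP (R : realType) (z : R[i]) : z != 0 ->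
  [/\ - pi < arg z <= pi, complex.Re z = cmod z * cos (arg z)
    & complex.Im z = cmod z * sin (arg z)].
Proof.
case: z => a b z0; rewrite /arg; set r := cmod _; rewrite /=.
have r2 : r ^+ 2 = a ^+ 2 + b ^+ 2.
  by rewrite /r /cmod /= sqr_sqrtr // addr_ge0 ?sqr_ge0.
have r0 : 0 < r.
  rewrite lt_neqAle sqrtr_ge0 andbT eq_sym.
  by apply: contra z0 => /eqP/Normc.eq0_normc ->.
have ar : -1 <= a / r <= 1.
  rewrite -ler_norml normrM normfV (gtr0_norm r0) ler_pdivrMr // mul1r.
  by rewrite -[leRHS](gtr0_norm r0) -ler_sqr ?nnegrE // !real_normK ?num_real // r2 lerDl sqr_ge0.
have s1 : r * Num.sqrt (1 - (a / r) ^+ 2) = `|b|.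
  rewrite -{1}(gtr0_norm r0) -sqrtr_sqr -sqrtrM ?sqr_ge0 // -sqrtr_sqr.
  congr Num.sqrt; rewrite mulrBr mulr1 exprMn exprVn mulrC -mulrA mulVf.
    by rewrite mulr1 r2 [a ^+ 2 + _]addrC addrK.
  by rewrite expf_neq0 // gt_eqF.
have c1 : r * (a / r) = a by rewrite mulrC divfK // gt_eqF.
have [b0|b0] := leP 0 b.
  rewrite sin_acos // acosK ?in_itv //= s1 ger0_norm // c1 acos_lepi // andbT.
  by split=> //; rewrite (lt_le_trans _ (acos_ge0 ar)) // oppr_lt0 pi_gt0.
rewrite cosN sinN sin_acos // acosK ?in_itv //= mulrN s1 ltr0_norm // opprK c1.
have acos_pi : acos (a / r) < pi.
  apply: acos_ltpi; case/andP: (ar) => a1 ->; rewrite andbT lt_neqAle a1 andbT.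
  apply: contraTneq b0 => ar1; have : b ^+ 2 = 0.
    apply: (addrI (a ^+ 2)); rewrite addr0 -r2.
    by rewrite -c1 -ar1 mulrN1 sqrrN.
  by move/eqP; rewrite sqrf_eq0 => /eqP ->; rewrite ltxx.
split=> //; rewrite ltrN2 acos_pi /= (@le_trans _ _ 0) ?pi_ge0 //.
by rewrite oppr_le0 acos_ge0.
Qed.

(* Main.v *)
Require Import Defs.
From mathcomp Require Import all_boot all_order all_fingroup all_algebra.
From mathcomp Require Import all_classical all_reals all_analysis.
From mathcomp Require Import complex.
From mathcomp Require Import mxred spectral ring zify.

Import Order.TTheory GRing.Theory Num.Theory.
Import numFieldNormedType.Exports.

Local Open Scope classical_set_scope.
Local Open Scope ring_scope.

(* Perron-Frobenius for a cone-primitive operator B: some power of B maps the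
   nonzero vectors of K into its interior, the least s for which
   s B x - x lies in K for some nonzero x in K yields an eigenvector inside K,
   and P = s B contracts the oscillation relative to that eigenvector
   (Doeblin), so that the powers of P converge to a matrix of trace 1.
   Apply this to the j-th exterior power of A for odd j, and triangularize A
   over the complex numbers: the diagonal of the exterior powers of the
   triangular matrix consists of the products of j eigenvalues, hence the
   powers of each such product divided by rho converge, to limits that are 0
   or 1 and sum up to 1.  So exactly one product equals rho > 0 and all others
   are smaller in modulus.  By maximality this one is
   lambda_1 ... lambda_j, and comparing it with
   lambda_1 ... lambda_{j-1} lambda_{j+1} gives
   |lambda_j| > |lambda_{j+1}|.  Quotients of consecutive prefix products show
   that lambda_i lambda_{i+1} > 0 for even i. *)

Set Implicit Arguments.
Unset Strict Implicit.
Unset Printing Implicit Defensive.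

(** * Compactness and continuity *)

Section Topology.
Variable R : realType.

Lemma mulmx_continuous m n p (B : 'M[R]_(m, n)) :
  continuous (fun X : 'M[R]_(n, p) => B *m X).
Proof.
rewrite (_ : (fun _ => _) = fun X : 'M[R]_(n, p) =>
   \sum_k \sum_j X k j *: (B *m delta_mx k j)).
  apply: continuous_big => [|k _]; first by apply: add_continuous.
  apply: continuous_big => [|j _]; first by apply: add_continuous.
  by move=> X; exact: cvgZr_tmp (@coord_continuous R n p k j X).
apply/funext => Y; rewrite {1}(matrix_sum_delta Y) mulmx_sumr; apply: eq_bigr => k _.
by rewrite mulmx_sumr; apply: eq_bigr => j _; rewrite scalemxAr.
Qed.

(** Heine-Borel for row vectors, carried over along the continuous transposition. *)
Lemma sphere_compact n : compact [set x : 'cV[R]_n | `|x| = 1].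
Proof.
have -> : [set x : 'cV[R]_n | `|x| = 1] = trmx @` [set x : 'rV[R]_n | `|x^T| = 1].
  apply/seteqP; split => [x x1|_ [y y1 <-] //].
  by exists x^T; rewrite ?trmxK //= trmxK.
have trc : continuous (trmx : 'rV[R]_n -> 'cV[R]_n).
  rewrite (_ : trmx = fun x : 'rV[R]_n =>
    \sum_j (x 0 j) *: (delta_mx 0 j : 'rV_n)^T).
    apply: continuous_big => [|j _]; first by apply: add_continuous.
    by move=> x; exact: cvgZr_tmp (@coord_continuous R 1 n 0 j x).
  apply/funext => y; rewrite {1}(row_sum_delta y) linear_sum; apply: eq_bigr => k _.
  by rewrite linearZ.
apply: continuous_compact; first by apply: continuous_subspaceT.
apply: bounded_closed_compact.
  exists 1; split => // t t1 x /= x1; rewrite -x1 in t1.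
  apply: le_trans (ltW t1); rewrite /Num.norm /= !mx_normrE.
  apply/bigmax_leP; split; first exact: bigmax_ge_id.
  move=> [i j] _ /=; apply/bigmax_geP; right; exists (j, i) => //=.
  by rewrite mxE.
rewrite (_ : mkset _ = (fun x => `|x^T|) @^-1` [set 1]) //.
apply: (continuous_closedP _).1; last exact: closed_eq.
have nc : continuous (fun y : 'cV[R]_n => `|y|) by move=> y; apply: norm_continuous.
by move=> x; apply: (continuous_comp (trc x) (nc x^T)).
Qed.

(** Tube lemma around the slice [s = s0]: compactness gives one [d] for all of [S]. Halving the
    radius turns an open ball into a closed one. *)
Lemma compact_param_nbhs (V T : topologicalType) (S : set V) (U : set T)
    (f : V * R -> T) (s0 : R) :
  compact S -> open U -> continuous f -> (forall x, S x -> U (f (x, s0))) ->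
  exists2 d : R, 0 < d & forall s, `|s - s0| <= d -> forall x, S x -> U (f (x, s)).
Proof.
move=> /compact_near_coveringP cS oU cf SU.
have : \forall s \near s0, forall x, S x -> U (f (x, s)).
  apply: (cS _ (nbhs s0) (fun s x => U (f (x, s)))) => x Sx.
  have := cf (x, s0) U (open_nbhs_nbhs (conj oU (SU x Sx))).
  by case=> [[X Y] [/= XX YY] XY]; exists (X, Y) => //= z zz; exact: XY.
move=> /(@nbhs_normP R R)[d d0 dP]; exists (d / 2); first by rewrite divr_gt0.
move=> s sd; apply: dP; rewrite /= distrC (le_lt_trans sd) //.
by rewrite ltr_pdivrMr // ltr_pMr // ltr1n.
Qed.

End Topology.

(** * Proper cones *)

Section ProperCone.
Variables (R : realType) (N : nat) (K : set 'cV[R]_N).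
Hypothesis K_proper : proper_cone K.

Lemma cone_add x y : K x -> K y -> K (x + y).
Proof. by case: K_proper => -[KD _] _ _ _; exact: KD. Qed.

Lemma cone_scale (a : R) x : 0 <= a -> K x -> K (a *: x).
Proof. by case: K_proper => -[_ KZ] _ _ _; exact: KZ. Qed.

Lemma cone0 : K 0.
Proof. by case: K_proper => _ + _ _ => /seteqP[_ /(_ 0 erefl)[]]. Qed.

Lemma cone_pointed x : K x -> K (- x) -> x = 0.
Proof.
case: K_proper => _ + _ _ => /seteqP[K0 _] Kx KNx; apply: K0; split => //.
by exists (- x); rewrite ?opprK.
Qed.

Lemma cone_open_compl : open (~` K).
Proof. by case: K_proper => _ _ cK _; exact: closed_openC. Qed.

Lemma interior_sub x : K° x -> K x.
Proof. exact: interior_subset. Qed.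

Lemma interior_normP e :
  K° e <-> exists2 d, 0 < d & forall y, `|y| < d -> K (e + y).
Proof.
rewrite /interior /=; split.
  move=> /(@nbhs_normP R 'cV[R]_N)[d d0 dK]; exists d => // y yd.
  by apply: dK; rewrite /= opprD addNKr normrN.
case=> d d0 dK; apply/(@nbhs_normP R 'cV[R]_N); exists d => // z /= zd.
by rewrite -(subrKC e z); apply: dK; rewrite distrC.
Qed.

Lemma interior_add x y : K° x -> K y -> K° (x + y).
Proof.
move=> /interior_normP[d d0 dK] Ky; apply/interior_normP; exists d => // z zd.
by rewrite addrAC; apply: cone_add => //; exact: dK.
Qed.

Lemma interior_scale (a : R) x : 0 < a -> K° x -> K° (a *: x).
Proof.
move=> a0 /interior_normP[d d0 dK]; apply/interior_normP; exists (a * d).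
  exact: mulr_gt0.
move=> y ya; rewrite -(scalerKV (lt0r_neq0 a0) y) -scalerDr.
apply: cone_scale (ltW a0) _; apply: dK.
by rewrite normrZ gtr0_norm ?invr_gt0 // mulrC ltr_pdivrMr // mulrC.
Qed.

Lemma nbhs_line (U : set 'cV[R]_N) (p v : 'cV[R]_N) : nbhs p U ->
  exists2 d : R, 0 < d & forall t : R, `|t| <= d -> U (p + t *: v).
Proof.
(* The [+ 1] keeps the denominator positive when [v = 0]. *)
move=> /(@nbhs_normP R 'cV[R]_N)[d d0 dU]; exists (d / (`|v| + 1)).
  by rewrite divr_gt0 // ltr_wpDl.
move=> t td; apply: dU; rewrite /= opprD addNKr normrN normrZ.
apply: le_lt_trans (_ : d / (`|v| + 1) * `|v| < d).
  by rewrite ler_wpM2r.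
by rewrite mulrAC ltr_pdivrMr ?ltr_wpDl // ltr_pM2l // ltrDl.
Qed.

Lemma interior_neq0 (N0 : (0 < N)%N) (e : 'cV[R]_N) : K° e -> e != 0.
Proof.
move=> Ke; apply/eqP => e0; rewrite {}e0 in Ke.
pose v : 'cV[R]_N := const_mx 1.
have [d d0 dK] := nbhs_line v Ke.
have : d *: v = 0.
  apply: cone_pointed; first by rewrite -[_ *: _]add0r; apply: dK; rewrite gtr0_norm.
  by rewrite -scaleNr -[_ *: _]add0r; apply: dK; rewrite normrN gtr0_norm.
move/(congr1 (fun z : 'cV_N => z (Ordinal N0) 0)); rewrite !mxE mulr1 => /eqP.
by rewrite gt_eqF.
Qed.

Lemma boundary_in x : K x -> ~ K° x -> boundary K x.
Proof. by move=> Kx nKx; split => //; exact: subset_closure. Qed.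

(** The crossing point sits at the infimum of the parameters where the segment is outside [K].
    Closedness puts it in [K]; outside parameters arbitrarily close to it keep it off the
    interior. *)
Lemma boundary_segment e y : K° e -> ~ K y ->
  exists t, [/\ 0 <= t, t <= 1 & boundary K (e + t *: (y - e))].
Proof.
move=> Ke nKy.
pose E := [set t : R | 0 <= t /\ ~ K (e + t *: (y - e))].
have E1 : E 1 by split => //; rewrite scale1r subrKC.
have hE : has_inf E by split; [exists 1|exists 0 => t []].
have i1 : inf E <= 1 by apply: ge_inf => //; exists 0 => t [].
have i0 : 0 <= inf E by apply: lb_le_inf => [|t []//]; exists 1.
exists (inf E); split => //.
have lt_inf t : 0 <= t -> t < inf E -> K (e + t *: (y - e)).
  move=> t0 ti; apply: contrapT => nK.
  by move: ti; rewrite ltNge => /negP; apply; apply: ge_inf => //; exists 0 => s [].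
set i := inf E in i1 i0 lt_inf *; set p := e + _.
have pE t : p + t *: (y - e) = e + (i + t) *: (y - e) by rewrite -addrA -scalerDl.
apply: boundary_in => [|/(nbhs_line (y - e))[d d0 dK]].
  apply: contrapT => nKp.
  have [d d0 dK] := nbhs_line (y - e) (open_nbhs_nbhs (conj cone_open_compl nKp)).
  have igt0 : 0 < i.
    rewrite lt_neqAle i0 andbT; apply: contra_notN nKp => /eqP i_0.
    by rewrite /p -i_0 scale0r addr0; exact: interior_sub.
  (* Going back by [t] keeps the parameter nonnegative and the point outside [K], although the
     segment lies in [K] below the infimum. *)
  pose t := Num.min d (i / 2).
  have t0 : 0 < t by rewrite lt_min d0 divr_gt0.
  have ti : t <= i / 2 by rewrite ge_min lexx orbT.
  have : ~ K (p + - t *: (y - e)).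
    by apply: dK; rewrite normrN gtr0_norm // ge_min lexx.
  rewrite pE; apply; apply: lt_inf; last by rewrite gtrDl oppr_lt0.
  by rewrite subr_ge0 (le_trans ti) // ler_pdivrMr // ler_peMr // ler1n.
have [t [t0 nKt] ti] := inf_adherent d0 hE.
have it : i <= t by apply: ge_inf => //; exists 0 => s [].
apply: nKt; rewrite -(subrKC i t) -pE; apply: dK.
by rewrite ger0_norm ?subr_ge0 // lerBlDl ltW.
Qed.

Lemma cone_sphere_compact : compact ([set x | `|x| = 1] `&` K).
Proof.
by case: K_proper => _ _ cK _; apply: compact_closedI => //; exact: sphere_compact.
Qed.

Lemma cone_normalize x : K x -> x != 0 ->
  ([set x | `|x| = 1] `&` K) (`|x|^-1 *: x).
Proof.
move=> Kx x0; have nx : 0 < `|x| by rewrite normr_gt0.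
split; last by apply: cone_scale => //; rewrite invr_ge0.
by rewrite /= normrZ normfV normr_id mulVf ?gt_eqF.
Qed.

Lemma interior_nN (N_gt0 : (0 < N)%N) (x : 'cV[R]_N) : K° x -> ~ K (- x).
Proof.
move=> Kx KNx; move: (interior_neq0 N_gt0 Kx).
by rewrite (cone_pointed (interior_sub Kx) KNx) eqxx.
Qed.

End ProperCone.

Lemma iter_mulmx (R : pzRingType) n p (B : 'M[R]_n) (X : 'M[R]_(n, p)) k :
  iter k (mulmx B) X = B ^+ k *m X.
Proof.
elim: k => [|k IH]; first by rewrite expr0 mul1mx.
by rewrite iterS IH mulmxA exprS.
Qed.

(** * Primitive operators *)

Section Primitive.
Variables (R : realType) (N : nat) (K : set 'cV[R]_N) (B : 'M[R]_N).
Hypotheses (N_gt0 : (0 < N)%N) (K_proper : proper_cone K).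
Hypothesis B_primitive : K_primitive K B.

Lemma primitive_cone x : K x -> K (B *m x).
Proof. by case: B_primitive => BK _ _ Kx; apply: BK; exists x. Qed.

Lemma interior_witness : exists e, K° e.
Proof. by case: K_proper => _ _ _ [e Ke]; exists e. Qed.

(* Join two independent interior vectors u, v, or v and - u, by a segment: it
   avoids 0 and has to leave K. *)
Lemma exists_boundary_neq0 : (1 < N)%N -> exists2 x, boundary K x & x != 0.
Proof.
move=> N1; have [u Ku] := interior_witness.
have u0 := interior_neq0 K_proper N_gt0 Ku.
have [i ui] : exists i, u i 0 != 0 by apply/cV0Pn.
have [j ij] : exists j : 'I_N, j != i.
  have : (0 < #|predC1 i|)%N by rewrite cardC1 card_ord -ltnS prednK.
  by move=> /card_gt0P[j]; exists j.
pose v : 'cV[R]_N := delta_mx j 0.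
have indep a b : a *: u + b *: v = 0 -> a = 0 /\ b = 0.
  move=> ab; have a0 : a = 0.
    move/(congr1 (fun z : 'cV_N => z i 0)): ab; rewrite !mxE eq_sym (negPf ij).
    by rewrite mulr0 addr0 => /eqP; rewrite mulf_eq0 (negPf ui) orbF => /eqP.
  split=> //; move/(congr1 (fun z : 'cV_N => z j 0)): ab; rewrite !mxE a0 !eqxx.
  by rewrite mul0r add0r mulr1.
have [Kv|nKv] := pselect (K v); last first.
  have [t [t0 t1 bt]] := boundary_segment K_proper Ku nKv; exists (u + t *: (v - u)) => //.
  apply/eqP => e; have [] := indep (1 - t) t.
    by rewrite -e scalerBl scalerBr scale1r addrAC addrA.
  by move=> /subr0_eq <- /eqP; rewrite oner_eq0.
have [Kiv|nKiv] := pselect (K° v); last first.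
  exists v; first exact: boundary_in.
  apply/eqP => v0; have [] := indep 0 1; first by rewrite scale0r add0r scale1r.
  by move=> _ /eqP; rewrite oner_eq0.
have nKu : ~ K (- u).
  move=> KNu; move: u0; rewrite (cone_pointed K_proper _ KNu) ?eqxx //.
  exact: interior_sub.
have [t [t0 t1 bt]] := boundary_segment K_proper Kiv nKu.
exists (v + t *: (- u - v)) => //.
apply/eqP => e; have [] := indep (- t) (1 - t).
  rewrite -e scalerBr scalerN scalerBl scale1r scaleNr.
  by rewrite [RHS]addrCA.
by move=> /eqP; rewrite oppr_eq0 => /eqP -> /eqP; rewrite subr0 oner_eq0.
Qed.

Lemma boundary0 : boundary K 0.
Proof.
apply: boundary_in; first exact: cone0 K_proper.
by move=> /(interior_neq0 K_proper N_gt0); rewrite eqxx.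
Qed.

(* If B = 0, every set {0, x} with x on the boundary is invariant. *)
Lemma primitive_neq0 : B != 0.
Proof.
case: B_primitive => _ inv N1.
have [/eqP/N1//|neq1] := boolP (N == 1%N).
have {}/exists_boundary_neq0[x bx x0] : (1 < N)%N.
  by rewrite ltn_neqAle eq_sym neq1.
apply/eqP => B0; have S0 : [set y | y = 0 \/ y = x] = [set 0].
  apply: inv => [|y [->|->] //|_ [y _ <-]]; first by exists x; right.
    exact: boundary0.
  by left; rewrite B0 mul0mx.
have : [set y | y = 0 \/ y = x] x by right.
by rewrite S0 => /= x00; rewrite x00 eqxx in x0.
Qed.

(** For small d > 0 the vector y - d x is in [K], and B y = d B x + B (y - d x). *)
Lemma primitive_interior_mul x : K x -> K° (B *m x) -> forall y, K° y -> K° (B *m y).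
Proof.
move=> Kx KBx y /(nbhs_line (- x))[d d0 dK].
have -> : B *m y = d *: (B *m x) + B *m (y + d *: - x).
  by rewrite mulmxDr -scalemxAr mulmxN scalerN addrCA subrr addr0.
apply: interior_add => //; first exact: interior_scale.
by apply: primitive_cone; apply: dK; rewrite gtr0_norm.
Qed.

(** Otherwise the orbit of [x] is an invariant subset of the boundary other than {0}. *)
Lemma primitive_orbit x : K x -> x != 0 -> exists k, K° (iter k (mulmx B) x).
Proof.
move=> Kx x0; apply: contrapT => nK.
have KB k : K (iter k (mulmx B) x) by elim: k => //= k; exact: primitive_cone.
have S0 : [set iter k (mulmx B) x | k in setT] = [set 0].
  case: B_primitive => _ inv _; apply: inv => [|_ [k _ <-]|_ [_ [k _ <-] <-]].
  - by exists x; exists 0%N.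
  - by apply: boundary_in => // Kk; apply: nK; exists k.
  - by exists k.+1.
have : [set iter k (mulmx B) x | k in setT] x by exists 0%N.
by rewrite S0 => /= x00; rewrite x00 eqxx in x0.
Qed.

(** If B y is not interior, [B] sends no vector of [K] into the interior. Then B y = 0 would put
    both d B e_j and - d B e_j in [K] for every j, forcing [B = 0]; and if B y is nonzero, its orbit
    reaches the interior, at an image of a vector of [K]. *)
Lemma primitive_interior y : K° y -> K° (B *m y).
Proof.
move=> Ky; have [//|nK] := pselect (K° (B *m y)).
have nKB z : K z -> ~ K° (B *m z).
  by move=> Kz KBz; apply: nK; exact: primitive_interior_mul KBz _ Ky.
have [By0|By0] := eqVneq (B *m y) 0.
  case/eqP: primitive_neq0; apply/matrixP => i j; rewrite [RHS]mxE.
  have [d d0 dK] := nbhs_line (delta_mx j 0) Ky.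
  have KdB s : `|s| <= d -> K (s *: (B *m delta_mx j 0)).
    by rewrite scalemxAr -[X in K X]add0r -By0 -mulmxDr => sd; exact/primitive_cone/dK.
  have : d *: (B *m delta_mx j (0 : 'I_1)) = 0.
    apply: (cone_pointed K_proper); first by apply: KdB; rewrite gtr0_norm.
    by rewrite -scaleNr; apply: KdB; rewrite normrN gtr0_norm.
  move/(congr1 (fun z : 'cV_N => z i 0)); rewrite -colE !mxE => /eqP.
  by rewrite mulf_eq0 gt_eqF //= => /eqP.
have KBy : K (B *m y) by apply: primitive_cone; exact: interior_sub.
have [[|k]] := primitive_orbit KBy By0; first by [].
move=> /= Kk; exfalso; apply: nKB Kk.
by elim: k => //= k; exact: primitive_cone.
Qed.

End Primitive.

(** * Existence of an interior eigenvector *)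

Section Perron.
Variables (R : realType) (N : nat) (K : set 'cV[R]_N) (B : 'M[R]_N).
Hypotheses (N_gt0 : (0 < N)%N) (K_proper : proper_cone K).
Hypothesis B_primitive : K_primitive K B.

(** An exponent that works for [x] also works near [x], and so do all larger ones; compactness of
    the unit sphere of [K] gives a common exponent, and scaling does the rest. *)
Lemma primitive_uniform : exists m, forall x, K x -> x != 0 -> K° (B ^+ m *m x).
Proof.
pose S := [set x : 'cV[R]_N | `|x| = 1] `&` K.
have step k l x : (k <= l)%N -> K° (B ^+ k *m x) -> K° (B ^+ l *m x).
  move=> /subnK <- Kk; elim: (l - k)%N => // p IH.
  by rewrite addSn exprS -mulmxA; exact: (primitive_interior N_gt0 K_proper).
have : \forall m \near \oo, S `<=` (fun x => K° (B ^+ m *m x)).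
  apply: (compact_near_coveringP _).1; first exact: cone_sphere_compact.
  move=> x [/= x1 Kx].
  have x0 : x != 0 by apply: contra_eq_neq x1 => ->; rewrite normr0 eq_sym oner_eq0.
  have [k Kk] := primitive_orbit B_primitive Kx x0.
  rewrite iter_mulmx in Kk.
  exists ([set y | K° (B ^+ k *m y)], [set l | (k <= l)%N]) => /=; last first.
    by move=> [y l] [/= ky kl]; exact: step ky.
  split; last by exists k.
  apply: (mulmx_continuous (p := 1)); exact: open_nbhs_nbhs (conj (@open_interior _ K) Kk).
case=> m _ mP; exists m => x Kx x0.
have nx : 0 < `|x| by rewrite normr_gt0.
rewrite -(scalerKV (lt0r_neq0 nx) x) -scalemxAr; apply: interior_scale => //.
by apply: (mP m) => //=; exact: cone_normalize.
Qed.

(* At the least s with s B x - x in K, the vector s B x - x is 0: otherwise its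
   image under B ^+ m is interior and s could be decreased for B ^+ m x. *)
Lemma primitive_eigenvector : exists s x, [/\ 0 < s, K° x & s *: (B *m x) = x].
Proof.
pose E := [set s : R | exists x, [/\ K x, x != 0 & K (s *: (B *m x) - x)]].
have E_gt0 s : E s -> 0 < s.
  move=> [x [Kx x0 Ks]]; rewrite ltNge; apply/negP => s0; move: x0.
  rewrite (cone_pointed K_proper Kx) ?eqxx //.
  have -> : - x = (s *: (B *m x) - x) + (- s) *: (B *m x).
    by rewrite scaleNr addrAC subrr add0r.
  apply: (cone_add K_proper) => //.
  apply: (cone_scale K_proper); first by rewrite oppr_ge0.
  exact: primitive_cone.
have [e Ke] := interior_witness K_proper.
have E0 : E !=set0.
  (* B e is interior, so B e - d e lies in [K] for some d > 0, which puts 1/d in [E]. *)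
  have [d d0 dK] := nbhs_line (- e) (primitive_interior N_gt0 K_proper B_primitive Ke).
  exists d^-1; exists e; split; [exact: interior_sub | exact: interior_neq0 Ke|].
  rewrite -[X in _ - X](scalerK (lt0r_neq0 d0)) -scalerBr.
  apply: (cone_scale K_proper); first by rewrite invr_ge0 ltW.
  by rewrite -scalerN; apply: dK; rewrite gtr0_norm.
have lbE : lbound E 0 by move=> s /E_gt0/ltW.
have hE : has_inf E by split => //; exists 0.
pose s := inf E.
(* The infimum is attained: if [s] failed on the whole unit sphere of [K], so would every parameter
   within some [d] of it, yet [E] has elements that close to its infimum. *)
have [x [[/= x1 Kx] Ks]] : exists x, ([set x | `|x| = 1] `&` K) x /\ K (s *: (B *m x) - x).
  apply: contrapT => nex.
  have [||d d0 dP] := @compact_param_nbhs R _ _ _ (~` K)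
      (fun z => z.2 *: (B *m z.1) - z.1) s (cone_sphere_compact K_proper)
      (cone_open_compl K_proper).
  - move=> z; apply: cvgB; last exact: cvg_fst.
    apply: cvgZ; first exact: cvg_snd.
    by apply: (cvg_comp _ _ cvg_fst); exact: mulmx_continuous.
  - by move=> x Sx /= Kx; apply: nex; exists x.
  have [t [x [Kx x0 Kt]] td] := inf_adherent d0 hE.
  apply: (dP t _ _ (cone_normalize K_proper Kx x0)) => /=.
    rewrite ger0_norm ?subr_ge0; first by rewrite lerBlDl ltW.
    by apply: ge_inf; [exists 0 | exists x].
  rewrite -scalemxAr scalerA mulrC -scalerA -scalerBr.
  by apply: (cone_scale K_proper) => //; rewrite invr_ge0.
have x0 : x != 0 by apply: contra_eq_neq x1 => ->; rewrite normr0 eq_sym oner_eq0.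
have s0 : 0 < s by apply: E_gt0; exists x.
have [m mP] := primitive_uniform.
have [y0|y0] := eqVneq (s *: (B *m x) - x) 0.
  have xE : s *: (B *m x) = x by apply/eqP; rewrite -subr_eq0 y0.
  exists s, x; split => //.
  (* This exhibits [x] as a positive multiple of an interior vector. *)
  have xm : s ^+ m *: (B ^+ m *m x) = x.
    elim: (m) => [|k IH]; first by rewrite !expr0 mul1mx scale1r.
    by rewrite !exprSr -mulmxA -scalerA scalemxAr xE IH.
  by rewrite -xm; apply: (interior_scale K_proper); rewrite ?exprn_gt0 //; exact: mP.
have := mP _ Ks y0; set z := B ^+ m *m x.
have Kz : K° z by exact: mP.
have -> : B ^+ m *m (s *: (B *m x) - x) = s *: (B *m z) - z.
  by rewrite mulmxBr -scalemxAr /z !mulmxA -[B ^+ m *m B]/(B ^+ m * B) -exprSr exprS.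
move=> /(nbhs_line (- (B *m z)))[d d0 dK].
have : s <= s - d.
  apply: ge_inf; first by exists 0.
  exists z; split; [exact: interior_sub | exact: interior_neq0 Kz |].
  rewrite scalerBl addrAC -scalerN; apply: dK; rewrite gtr0_norm //.
by rewrite lerDl oppr_ge0 leNgt d0.
Qed.
End Perron.

(** * Convergence of the normalized powers *)

Section Contraction.
Variables (R : realType) (N : nat) (K : set 'cV[R]_N) (P : 'M[R]_N).
Variables (x : 'cV[R]_N) (m : nat).
Hypotheses (N_gt0 : (0 < N)%N) (K_proper : proper_cone K).
Hypotheses (P_cone : forall y, K y -> K (P *m y)) (Px : P *m x = x) (Kx : K° x).
Hypothesis P_strict : forall y, K y -> y != 0 -> K° (P ^+ m *m y).

Lemma expmx_fix k : P ^+ k *m x = x.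
Proof. by elim: k => [|k IH]; rewrite ?expr0 ?mul1mx // exprSr -mulmxA Px. Qed.

Lemma expmx_cone k y : K y -> K (P ^+ k *m y).
Proof.
by elim: k => [|k IH] Ky; rewrite ?expr0 ?mul1mx // exprS -mulmxA; exact/P_cone/IH.
Qed.

Lemma expmx_lower k a y : K (y - a *: x) -> K (P ^+ k *m y - a *: x).
Proof. by move/(expmx_cone k); rewrite mulmxBr -scalemxAr expmx_fix. Qed.

Lemma expmx_upper k b y : K (b *: x - y) -> K (b *: x - P ^+ k *m y).
Proof. by move/(expmx_cone k); rewrite mulmxBr -scalemxAr expmx_fix. Qed.

Lemma cone_line_ge0 t : K (t *: x) -> 0 <= t.
Proof.
move=> Kt; rewrite leNgt; apply/negP => t0; apply: (interior_nN K_proper N_gt0 Kx).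
have : K ((- t)^-1 *: (t *: x)).
  by apply: (cone_scale K_proper) => //; rewrite invr_ge0 oppr_ge0 ltW.
by rewrite scalerA invrN mulNr mulVf ?lt_eqF // scaleN1r.
Qed.

Lemma order_unit_le a b y : K (y - a *: x) -> K (b *: x - y) -> a <= b.
Proof.
move=> Ka Kb; rewrite -subr_ge0; apply: cone_line_ge0; rewrite scalerBl.
by have := cone_add K_proper Kb Ka; rewrite addrA subrK.
Qed.

(* Since u + (x - u) = x, one of the two has norm at least |x| / 2, and on the
   unit sphere of K the operator P ^+ m dominates a fixed multiple of x. *)
Lemma expmx_minorize : exists2 eps : R, 0 < eps < 1 & forall u, K u -> K (x - u) ->
  K (P ^+ m *m u - eps *: x) \/ K (P ^+ m *m (x - u) - eps *: x).
Proof.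
have x0 : 0 < `|x|.
  by rewrite normr_gt0; exact: interior_neq0 K_proper N_gt0 _ Kx.
(* On the unit sphere of [K] the image under [P ^+ m] is interior; [d] is a multiple of [x] that can
   be subtracted uniformly. *)
have [||d d0 dP] := @compact_param_nbhs R _ _ _ (interior K)
   (fun z => P ^+ m *m z.1 - z.2 *: x) 0 (cone_sphere_compact K_proper) (@open_interior _ _).
- move=> z; apply: cvgB.
    by apply: (cvg_comp _ _ cvg_fst); exact: mulmx_continuous.
  by apply: cvgZr_tmp; exact: cvg_snd.
- move=> y [/= y1 Ky]; rewrite scale0r subr0; apply: P_strict => //.
  by apply: contra_eq_neq y1 => ->; rewrite normr0 eq_sym oner_eq0.
have lower u t : K u -> 0 <= t <= d * `|u| -> u != 0 -> K (P ^+ m *m u - t *: x).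
  move=> Ku /andP[t0 td] u0.
  have nu : 0 < `|u| by rewrite normr_gt0.
  have -> : P ^+ m *m u - t *: x =
      `|u| *: (P ^+ m *m (`|u|^-1 *: u) - (`|u|^-1 * t) *: x).
    by rewrite scalerBr -scalemxAr !scalerA mulrA divff ?gt_eqF // scale1r mul1r.
  apply: (cone_scale K_proper (ltW nu)); apply: interior_sub.
  apply: (dP (`|u|^-1 * t) _ _ (cone_normalize K_proper Ku u0)).
  by rewrite subr0 ger0_norm ?mulr_ge0 ?invr_ge0 // mulrC ler_pdivrMr.
(* The first term serves vectors of norm at least |x| / 2; the second ensures [eps < 1]. *)
pose eps := Num.min (d * (`|x| / 2)) (1 / 2).
have e0 : 0 < eps by rewrite lt_min !mulr_gt0 ?invr_gt0.
have e1 : eps < 1.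
  by rewrite (@le_lt_trans _ _ (1 / 2)) // ?ge_min ?lexx ?orbT // ltr_pdivrMr // mul1r ltr1n.
have low u : K u -> `|x| / 2 <= `|u| -> K (P ^+ m *m u - eps *: x).
  move=> Ku xu; apply: lower => //.
    rewrite ltW //= (@le_trans _ _ (d * (`|x| / 2))) ?ge_min ?lexx //.
    by rewrite ler_pM2l.
  by rewrite -normr_gt0 (lt_le_trans _ xu) // divr_gt0.
exists eps; first by rewrite e0.
move=> u Ku Kxu; have [ux|ux] := leP (`|x| / 2) `|u|; first by left; exact: low.
right; apply: low => //; rewrite leNgt; apply/negP => xux.
have := ler_normD u (x - u); rewrite subrKC leNgt => /negP; apply.
by rewrite [ltRHS](splitr `|x|); exact: ltrD.
Qed.

(* Normality of the cone: on the unit sphere, v and - v cannot both be nearly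
   in K. *)
Lemma order_interval_norm : exists2 M : R, 0 < M &
  forall t v, K (t *: x + v) -> K (t *: x - v) -> `|v| <= M * t.
Proof.
have [|||d d0 dP] := @compact_param_nbhs R _ ('cV[R]_N * 'cV[R]_N)%type
   [set v : 'cV[R]_N | `|v| = 1] (~` (K `*` K))
   (fun z => (z.2 *: x + z.1, z.2 *: x - z.1)) 0 (@sphere_compact _ _).
- rewrite (_ : ~` (K `*` K) = fst @^-1` (~` K) `|` snd @^-1` (~` K)); last first.
    apply/seteqP; split=> -[a b] /=; last by case=> nK [].
    by move=> nK; apply: contrapT => /not_orP[/contrapT Ka /contrapT Kb]; apply: nK.
  have oK := cone_open_compl K_proper.
  by apply: openU; apply: open_comp => // z _; [exact: cvg_fst | exact: cvg_snd].
- move=> z.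
  have c1 : z0.2 *: x @[z0 --> z] --> z.2 *: x by apply: cvgZr_tmp; exact: cvg_snd.
  have c2 : z0.1 @[z0 --> z] --> z.1 by exact: cvg_fst.
  exact: cvg_pair (cvgD c1 c2) (cvgB c1 c2).
- move=> v /= v1 [/=]; rewrite scale0r !add0r => Kv KNv.
  move: v1; rewrite (cone_pointed K_proper Kv KNv) normr0 => /eqP.
  by rewrite eq_sym oner_eq0.
exists d^-1; first by rewrite invr_gt0.
move=> t v Kp Km.
have t0 : 0 <= t.
  suff : - t <= t by rewrite lerNl -subr_ge0 opprK -mulr2n pmulrn_lge0.
  by apply: (@order_unit_le _ _ v) => //; rewrite scaleNr opprK addrC.
have [->|v0] := eqVneq v 0; first by rewrite normr0 mulr_ge0 // invr_ge0 ltW.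
have nv : 0 < `|v| by rewrite normr_gt0.
rewrite leNgt; apply/negP => tv.
have := dP (`|v|^-1 * t) _ (`|v|^-1 *: v).
case.
- rewrite subr0 ger0_norm ?mulr_ge0 ?invr_ge0 // mulrC ler_pdivrMr //.
  by rewrite -ler_pdivrMl // ltW.
- by rewrite /= normrZ normfV normr_id mulVf ?gt_eqF.
by split; rewrite /= -scalerA -?scalerBr -?scalerDr; apply: (cone_scale K_proper) => //;
  rewrite invr_ge0.
Qed.

(** For u = (y - a x) / (b - a) one has x - u = (b x - y) / (b - a), so the minorization either
    raises the lower bound [a] or lowers the upper bound [b] by eps (b - a). *)
Lemma expmx_contract : exists2 eps : R, 0 < eps < 1 & forall a b y,
  K (y - a *: x) -> K (b *: x - y) -> exists a' b',
  [/\ K (P ^+ m *m y - a' *: x), K (b' *: x - P ^+ m *m y)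
    & b' - a' = (1 - eps) * (b - a)].
Proof.
have [eps e01 epsP] := expmx_minorize; exists eps => // a b y Ka Kb.
have [ab|ab] := eqVneq a b.
  exists a, b; split; [exact: expmx_lower | exact: expmx_upper |].
  by rewrite ab subrr mulr0.
have ba : 0 < b - a.
  by rewrite subr_gt0 lt_neqAle ab; exact: order_unit_le Ka Kb.
have scaled z : K z -> K ((b - a)^-1 *: z).
  by move=> Kz; apply: (cone_scale K_proper); rewrite ?invr_ge0 ?ltW.
have xu : x - (b - a)^-1 *: (y - a *: x) = (b - a)^-1 *: (b *: x - y).
  rewrite -{1}(scalerK (lt0r_neq0 ba) x) -scalerBr scalerBl; congr (_ *: _).
  by rewrite opprB addrA subrK.
have [] := epsP _ (scaled _ Ka); first by rewrite xu; exact: scaled.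
  move=> /(cone_scale K_proper (ltW ba)) Ke.
  exists (a + (b - a) * eps), b; split; last by ring.
    move: Ke; rewrite scalerBr -scalemxAr scalerKV ?gt_eqF // scalerA.
    by rewrite mulmxBr -scalemxAr expmx_fix scalerDl opprD addrA.
  exact: expmx_upper.
rewrite xu => /(cone_scale K_proper (ltW ba)) Ke.
exists a, (b - (b - a) * eps); split; last by ring.
  exact: expmx_lower.
move: Ke; rewrite scalerBr -scalemxAr scalerKV ?gt_eqF // scalerA.
by rewrite mulmxBr -scalemxAr expmx_fix scalerBl addrAC.
Qed.

(** The iterates are caught between multiples of [x] whose gap shrinks geometrically. The limit
    coefficient is the supremum of all lower coefficients, and [order_interval_norm] turns order
    bounds into norm bounds. *)
Lemma expmx_cvg y : exists c : R, (fun k => P ^+ k *m y) @ \oo --> c *: x.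
Proof.
have [eps /andP[e0 e1] epsP] := expmx_contract.
have [M M0 MP] := order_interval_norm.
have [d d0 dK] := nbhs_line y Kx.
have di : 0 < d^-1 by rewrite invr_gt0.
have nested k : exists a b, [/\ K (P ^+ (m * k) *m y - a *: x),
    K (b *: x - P ^+ (m * k) *m y) & b - a = (1 - eps) ^+ k * (2 / d)].
  elim: k => [|k [a [b [Ka Kb ba]]]].
    (* Both x + d y and x - d y are in [K], so [y] starts between - x / d and x / d. *)
    exists (- d^-1), d^-1; rewrite muln0 !expr0 mul1mx mul1r; split; last by ring.
      rewrite scaleNr opprK -{1}(scalerK (lt0r_neq0 d0) y) -scalerDr addrC.
      by apply: (cone_scale K_proper (ltW di)); apply: dK; rewrite gtr0_norm.
    rewrite -{1}(scalerK (lt0r_neq0 d0) y) -scalerBr -scaleNr.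
    by apply: (cone_scale K_proper (ltW di)); apply: dK; rewrite normrN gtr0_norm.
  have [a' [b' [Ka' Kb' ba']]] := epsP _ _ _ Ka Kb.
  exists a', b'; rewrite mulnS exprD -mulmxA; split => //.
  by rewrite ba' ba exprS mulrA.
pose A := [set a | exists k, K (P ^+ k *m y - a *: x)].
(* Bounds for the iterates [k] and [l] are compared at the iterate [k + l], where both still
   hold. *)
have Aub k b : K (b *: x - P ^+ k *m y) -> ubound A b.
  move=> Kb a [l Ka]; apply: (@order_unit_le a b (P ^+ (k + l) *m y)).
    by rewrite exprD -mulmxA; exact: expmx_lower.
  by rewrite addnC exprD -mulmxA; exact: expmx_upper.
have [a0 [b0 [Ka0 Kb0 _]]] := nested 0%N.
have hA : has_sup A by split; [exists a0; exists (m * 0)%N | exists b0; exact: Aub Kb0].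
exists (sup A).
apply/cvgrPdist_le => /= e ee.
have e10 : `|1 - eps| < 1.
  by rewrite ger0_norm ?subr_ge0 1?ltW // gtrBl.
(* Chosen so that the norm bound M (b - a) at stage [q] is below [e]. *)
have /cvgrPdist_lt /(_ (e / (M * (2 / d)))) := cvg_expr e10.
case=> [|q _ /(_ q (leqnn q))] /=; first by rewrite !divr_gt0 // mulr_gt0 ?divr_gt0.
rewrite sub0r normrN ger0_norm ?exprn_ge0 ?subr_ge0 1?ltW //.
rewrite ltr_pdivlMr ?mulr_gt0 ?divr_gt0 // => qe.
have [a [b [Ka Kb ba]]] := nested q.
have aA : a <= sup A by apply: ub_le_sup; [case: hA | exists (m * q)%N].
have Ab : sup A <= b by apply: ge_sup; [case: hA | exact: Aub Kb].
exists (m * q)%N => // k /= qk.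
rewrite -(subnK qk) exprD -mulmxA.
have {}Ka := expmx_lower (k - m * q) Ka.
have {}Kb := expmx_upper (k - m * q) Kb.
set z := _ *m _ in Ka Kb *.
apply: (@le_trans _ _ (M * (b - a))); last first.
  by rewrite ba mulrCA ltW.
have Kt t : 0 <= t -> K (t *: x).
  by move=> t0; apply: (cone_scale K_proper t0); exact: interior_sub.
apply: MP.
  have -> : (b - a) *: x + (sup A *: x - z) = (b *: x - z) + (sup A - a) *: x.
    by apply/matrixP => i j; rewrite !mxE; ring.
  by apply: (cone_add K_proper) => //; apply: Kt; rewrite subr_ge0.
have -> : (b - a) *: x - (sup A *: x - z) = (z - a *: x) + (b - sup A) *: x.
  by apply/matrixP => i j; rewrite !mxE; ring.
by apply: (cone_add K_proper) => //; apply: Kt; rewrite subr_ge0.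
Qed.

(** Column j of [P ^+ k] is the k-th iterate of e_j, hence tends to a multiple of [x]. The trace of
    the limit is recorded because it survives a change of basis. *)
Lemma expmx_cvg_rank1 : exists L : 'M[R]_N,
  [/\ \tr L = 1 & forall i j, (fun k => (P ^+ k) i j) @ \oo --> L i j].
Proof.
have [c cP] := choice (fun j : 'I_N => expmx_cvg (delta_mx j 0)).
have entry i j : (fun k => (P ^+ k) i j) @ \oo --> c j * x i 0.
  have := cvg_comp _ _ (cP j) (@coord_continuous R N 1 i 0 (c j *: x)).
  rewrite mxE; apply: cvg_trans; apply: near_eq_cvg; apply: nearW => k /=.
  by rewrite -colE mxE.
(* The limit is x times the row c; its trace c x is 1 because P fixes x. *)
exists (\matrix_(i, j) (c j * x i 0)); split; last by move=> i j; rewrite mxE; exact: entry.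
have /cV0Pn[i xi] := interior_neq0 K_proper N_gt0 Kx.
have lim1 : (fun k => (P ^+ k *m x) i 0) @ \oo --> \sum_j c j * x i 0 * x j 0.
  rewrite (_ : (fun _ => _) = fun k => \sum_j (P ^+ k) i j * x j 0); last first.
    by apply/funext => k; rewrite mxE.
  apply: cvg_big => [|j _]; first by apply: add_continuous.
  by apply: cvgMl; exact: entry.
have lim2 : (fun k => (P ^+ k *m x) i 0) @ \oo --> x i 0.
  by rewrite (_ : (fun _ => _) = fun=> x i 0); [exact: cvg_cst | apply/funext => k; rewrite expmx_fix].
have := cvg_unique _ lim1 lim2 => /(_ _)/= E.
apply: (mulIf xi); rewrite mul1r -[RHS]E; last exact: norm_hausdorff.
rewrite /mxtrace mulr_suml; apply: eq_bigr => j _; rewrite mxE; ring.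
Qed.

End Contraction.

Lemma primitive_cvg (R : realType) (N : nat) (K : set 'cV[R]_N) (B : 'M[R]_N) :
  (0 < N)%N -> proper_cone K -> K_primitive K B ->
  exists (rho : R) (L : 'M[R]_N), [/\ 0 < rho, \tr L = 1 &
    forall i j, (fun k => (B ^+ k) i j / rho ^+ k) @ \oo --> L i j].
Proof.
move=> N0 Kp Bp; have [s [x [s0 Kx sBx]]] := primitive_eigenvector N0 Kp Bp.
have [m mP] := primitive_uniform N0 Kp Bp.
have PE k : (s *: B) ^+ k = s ^+ k *: B ^+ k.
  elim: k => [|k IH]; first by rewrite !expr0 scale1r.
  by rewrite !exprS IH -[LHS]/(_ *m _) -scalemxAl -scalemxAr scalerA.
have [||||L [trL LP]] := @expmx_cvg_rank1 R N K (s *: B) x m N0 Kp.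
- move=> y Ky; rewrite -scalemxAl; apply: (cone_scale Kp (ltW s0)).
  exact: primitive_cone Ky.
- by rewrite -scalemxAl.
- by [].
- move=> y Ky y0; rewrite PE -scalemxAl; apply: (interior_scale Kp).
    exact: exprn_gt0.
  exact: mP.
exists s^-1, L; split; rewrite ?invr_gt0 // => i j.
apply: cvg_trans (LP i j); apply: near_eq_cvg; apply: nearW => k.
by rewrite PE mxE exprVn invrK mulrC.
Qed.

(** * Exterior powers over commutative rings *)

Section Compound.
Variable F : comNzRingType.

(** The j-th compound matrix: [ext_power] expressed by minors, over any commutative ring, so that it
    also applies to the complex triangular form of [A]. *)
Definition compound n j (A : 'M[F]_n) : 'M[F]_('C(n, j)) :=
  \matrix_(s, t) \det (mxsub (tnth (multi_index s)) (tnth (multi_index t)) A).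

(** Cauchy-Binet: expand over all maps [f]. Those that are not injective repeat a row; the others
    are increasing families composed with permutations, whose signs reassemble the minors of [M]. *)
Lemma det_mulmx_minors n j (M : 'M[F]_(j, n)) (X : 'M[F]_(n, j)) :
  \det (M *m X) = \sum_(s < 'C(n, j))
    \det (colsub (tnth (multi_index s)) M) *
    \det (rowsub (tnth (multi_index s)) X).
Proof.
pose G (f : {ffun 'I_j -> 'I_n}) := \prod_i M i (f i) * \det (rowsub f X).
transitivity (\sum_f G f).
  under [RHS]eq_bigr do rewrite /G big_distrr; rewrite exchange_big /=.
  apply: eq_bigr => p _.
  transitivity ((-1) ^+ p * \prod_i \sum_k M i k * X k (p i)).
    by congr (_ * _); apply: eq_bigr => i _; rewrite mxE.
  rewrite bigA_distr_bigA big_distrr /=; apply: eq_bigr => f _.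
  rewrite big_split /= mulrCA; congr (_ * (_ * _)).
  by apply: eq_bigr => i _; rewrite mxE.
rewrite (bigID (fun f : {ffun 'I_j -> 'I_n} => injectiveb f)) /= addrC big1 ?add0r.
  rewrite (eq_bigl (fun f => f \in [set f : {ffun 'I_j -> 'I_n} | injectiveb f]%SET));
    last by move=> f; rewrite inE.
  rewrite -perm_index_image big_imset /=; last by move=> ? ? _ _ /perm_index_inj.
  rewrite (eq_bigl predT) // -(pair_bigA _ (fun s u => G (perm_index (s, u)))) /=.
  apply: eq_bigr => s _; rewrite big_distrl /=; apply: eq_bigr => u _.
  have -> : G (perm_index (s, u)) = \prod_i M i (tnth (multi_index s) (u i)) *
      \det (row_perm u (rowsub (tnth (multi_index s)) X)).
    congr (_ * _); first by apply: eq_bigr => i _; rewrite ffunE.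
    by congr (\det _); apply/matrixP => a b; rewrite !mxE ffunE.
  rewrite row_permE det_mulmx det_perm mulrA [_ * (-1) ^+ _]mulrC; congr (_ * _ * _).
  by apply: eq_bigr => i _; rewrite mxE.
move=> f /injectivePn[i1 [i2 i12 fi12]].
by rewrite /G (determinant_alternate i12) ?mulr0 // => k; rewrite !mxE fi12.
Qed.

Lemma compoundM n j (A B : 'M[F]_n) :
  compound j (A *m B) = compound j A *m compound j B.
Proof.
apply/matrixP => s t; rewrite !mxE mxsub_mul det_mulmx_minors.
by apply: eq_bigr => r _; rewrite !mxE -!mxsub_comp.
Qed.

Lemma compound1 n j : compound j (1%:M : 'M[F]_n) = 1%:M.
Proof.
apply/matrixP => s t; rewrite !mxE; have [->|st] := eqVneq s t.
  rewrite -[RHS](det1 F j); congr (\det _); apply/matrixP => a b.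
  by rewrite !mxE (inj_eq (@tnth_multi_index_inj _ _ t)).
have uniq_mi (r : 'I_('C(n, j))) : uniq (multi_index r).
  by apply/tuple_uniqP; exact: tnth_multi_index_inj.
have [i sit] : exists i, tnth (multi_index s) i \notin multi_index t.
  apply/existsP; apply: contraR st => /existsPn sub.
  apply/eqP/multi_index_eq_mem.
  have {}sub : {subset multi_index s <= multi_index t}.
    by move=> _ /tnthP[i ->]; have := sub i; rewrite negbK.
  by case: (uniq_min_size (uniq_mi s) sub); rewrite ?size_tuple.
rewrite (expand_det_row _ i) big1 // => k _; rewrite !mxE.
by case: eqP sit => [->|_ _]; rewrite ?mem_tnth // mul0r.
Qed.

Lemma compoundX n j (A : 'M[F]_n) k : compound j (A ^+ k) = compound j A ^+ k.
Proof.
elim: k => [|k IH]; first by rewrite !expr0; exact: compound1.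
by rewrite !exprS -IH; exact: compoundM.
Qed.

Lemma trig_mulmx n (A B : 'M[F]_n) : is_trig_mx A -> is_trig_mx B ->
  is_trig_mx (A *m B) /\ forall i, (A *m B) i i = A i i * B i i.
Proof.
move=> /is_trig_mxP At /is_trig_mxP Bt; split.
  apply/is_trig_mxP => i j ij; rewrite mxE big1 // => k _.
  have [ik|ki] := ltnP i k; first by rewrite At ?mul0r.
  by rewrite Bt ?mulr0 // (leq_ltn_trans ki).
move=> i; rewrite mxE (bigD1 i) //= big1 ?addr0 // => k.
rewrite neq_ltn => /orP[ki|ik]; first by rewrite Bt ?mulr0.
by rewrite At ?mul0r.
Qed.

Lemma trig_expmx n (A : 'M[F]_n) k : is_trig_mx A ->
  is_trig_mx (A ^+ k) /\ forall i, (A ^+ k) i i = A i i ^+ k.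
Proof.
move=> At; elim: k => [|k [IHt IHd]].
  by rewrite expr0; split=> [|i]; rewrite ?scalar_mx_is_trig // mxE eqxx.
rewrite exprS; have [ABt ABd] := trig_mulmx At IHt; split => // i.
by rewrite ABd IHd exprS.
Qed.

(** Multi-indices increase, so a principal submatrix of a triangular matrix is triangular. *)
Lemma compound_trig n j (A : 'M[F]_n) s : is_trig_mx A ->
  compound j A s s = \prod_(i < j) A (tnth (multi_index s) i) (tnth (multi_index s) i).
Proof.
move=> /is_trig_mxP At; rewrite mxE det_trig.
  by apply: eq_bigr => i _; rewrite mxE.
apply/is_trig_mxP => a b ab; rewrite mxE At //.
have := multi_index_sorted s; set m := multi_index s.
rewrite sorted_map => /(sorted_ltn_nth (leT := relpre val ltn)).
move=> /(_ (fun y x z => @ltn_trans _ _ _))/(_ (tnth m a) a b).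
by rewrite !inE size_tuple -!tnth_nth; apply.
Qed.

End Compound.

Lemma map_compound (F G : comNzRingType) (f : {rmorphism F -> G}) n j (A : 'M[F]_n) :
  map_mx f (compound j A) = compound j (map_mx f A).
Proof. by apply/matrixP => s t; rewrite !mxE -det_map_mx map_mxsub. Qed.

Lemma ext_power_compound (R : realType) n j (A : 'M[R]_n) :
  ext_power j A = compound j A.
Proof.
apply/matrixP => s t; rewrite !mxE; congr (\det _); apply/matrixP => a b.
rewrite !mxE (bigD1 (tnth (multi_index t) b)) //= big1 => [|k kt].
  by rewrite !mxE eqxx mulr1 addr0.
by rewrite !mxE (negPf kt) mulr0.
Qed.

(** * Dominant products of eigenvalues *)

Section PowerLimits.
Variable C : numFieldType.

(** Shifting the sequence gives z l = l, so z = 1 or l = 0; in the second case some power of [z],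
    hence [z] itself, has modulus below 1. *)
Lemma cvg_powers (z l : C) : (fun k => z ^+ k) @ \oo --> l ->
  z = 1 /\ l = 1 \/ `|z| < 1 /\ l = 0.
Proof.
move=> zl.
have zl1 : (fun k => z ^+ k.+1) @ \oo --> l by rewrite (cvg_shiftS (fun k => z ^+ k)).
have zl2 : (fun k => z ^+ k.+1) @ \oo --> z * l.
  by rewrite (_ : (fun _ => _) = fun k => z * z ^+ k); [exact: cvgMr | apply/funext => k; rewrite exprS].
have /esym/eqP : z * l = l by apply: cvg_unique zl2 zl1; exact: norm_hausdorff.
rewrite -subr_eq0 -{1}[l]mul1r -mulrBl mulf_eq0 subr_eq0 => /orP[/eqP z1|/eqP l0].
  left; split=> //; apply: cvg_unique zl _; first exact: norm_hausdorff.
  by rewrite -z1 (_ : (fun _ => _) = fun=> 1); [exact: cvg_cst | apply/funext => k; rewrite expr1n].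
right; split=> //; rewrite l0 in zl.
have /cvgr0Pnorm_lt /(_ 1 ltr01)[k _ /(_ k (leqnn k))] /= := zl.
rewrite normrX => zk; rewrite real_ltNge ?normr_real ?real1 //.
apply/negP => /(exprn_ege1 k).
by rewrite real_leNgt ?realX ?normr_real ?real1 // zk.
Qed.

(** Each limit is 1 or 0 according to whether [z s = 1], so their sum counts these [s]. *)
Lemma cvg_powers_sum1 (I : finType) (z l : I -> C) :
  (forall s, (fun k => z s ^+ k) @ \oo --> l s) -> \sum_s l s = 1 ->
  exists2 s, z s = 1 & forall t, t != s -> `|z t| < 1.
Proof.
move=> zl l1; have dich s := cvg_powers (zl s).
have lE s : l s = (z s == 1)%:R.
  case: (dich s) => [[-> ->]|[z1 ->]]; first by rewrite eqxx.
  by case: eqP z1 => // ->; rewrite normr1 ltxx.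
have : #|[pred s | z s == 1]| == 1%N.
  rewrite -(eqr_nat C) -sum1_card natr_sum big_mkcond; apply/eqP; rewrite -[RHS]l1.
  by apply: eq_bigr => s _; rewrite lE inE; case: eqP.
case/fintype.card1P => s sP.
exists s; first by have := sP s; rewrite !inE eqxx => /eqP.
move=> t ts; case: (dich t) => [[/eqP]|[]//].
by have := sP t; rewrite !inE (negPf ts) => ->.
Qed.

(** Every positive [e] is assumed to come from a positive real, as in [R[i]], where positive
    elements are real; so error bounds pull back along [f]. *)
Lemma cvg_rmorph (R : realType) (f : {rmorphism R -> C}) (u : nat -> R) (l : R) :
  (forall x, `|f x| = f `|x|) -> (forall e : C, 0 < e -> exists2 d : R, 0 < d & f d = e) ->
  {mono f : x y / x < y} ->
  u @ \oo --> l -> (fun k => f (u k)) @ \oo --> f l.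
Proof.
move=> fn fe fm /cvgrPdist_lt ul; apply/cvgrPdist_lt => e /fe[d d0 <-].
by apply: filterS (ul _ d0) => k; rewrite -rmorphB fn fm.
Qed.

End PowerLimits.

Section DominantProduct.
Variables (R : realType) (C : numFieldType) (f : {rmorphism R -> C}).
Hypothesis f_norm : forall x, `|f x| = f `|x|.
Hypothesis f_pos : forall e : C, 0 < e -> exists2 d : R, 0 < d & f d = e.
Hypothesis f_lt : {mono f : x y / x < y}.

Lemma dominant_product n j (A : 'M[R]_n) (Q T : 'M[C]_n)
    (K : set 'cV[R]_('C(n, j))) :
  (j <= n)%N -> proper_cone K -> K_primitive K (ext_power j A) ->
  Q \in unitmx -> is_trig_mx T -> Q *m map_mx f A = T *m Q ->
  exists2 rho : R, 0 < rho & exists2 s : 'I_('C(n, j)),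
    \prod_(i < j) T (tnth (multi_index s) i) (tnth (multi_index s) i) = f rho &
    forall t, t != s ->
      `|\prod_(i < j) T (tnth (multi_index t) i) (tnth (multi_index t) i)| < f rho.
Proof.
move=> jn Kp Bp Qu Tt QA.
have N0 : (0 < 'C(n, j))%N by rewrite bin_gt0.
have [rho [L [rho0 trL LP]]] := primitive_cvg N0 Kp Bp.
rewrite ext_power_compound in LP.
exists rho => //.
have frho0 : 0 < f rho by rewrite -(rmorph0 f) f_lt.
pose mu s := \prod_(i < j) T (tnth (multi_index s) i) (tnth (multi_index s) i).
pose cQ := compound j Q; pose cQi := compound j (invmx Q).
have QiQ : cQi *m cQ = 1%:M by rewrite -compoundM mulVmx // compound1.
have TX k : T ^+ k *m Q = Q *m map_mx f A ^+ k.
  elim: k => [|k IH]; first by rewrite !expr0 mul1mx mulmx1.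
  by rewrite exprS -mulmxA IH mulmxA -QA exprS -mulmxA.
(* The diagonal is read off from [compound j (T ^+ k)] with [T ^+ k] triangular, so the order of the
   multi-indices does not matter. *)
have mu_k s k : mu s ^+ k = (cQ *m map_mx f (compound j A ^+ k) *m cQi) s s.
  have -> : map_mx f (compound j A ^+ k) = compound j (map_mx f A ^+ k).
    rewrite compoundX -map_compound.
    elim: k => [|k IH]; first by rewrite !expr0 map_mx1.
    by rewrite !exprS -IH; exact: map_mxM.
  rewrite -!compoundM -TX mulmxK //.
  have [Tkt Tkd] := trig_expmx k Tt.
  by rewrite compound_trig // -prodrXl; apply: eq_bigr => i _; rewrite Tkd.
(* Since [cQi] inverts [cQ], these numbers sum up to the trace of [L], which is 1. *)
pose l s := (cQ *m map_mx f L *m cQi) s s.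
have mul s : (fun k => (mu s / f rho) ^+ k) @ \oo --> l s.
  rewrite (_ : (fun _ => _) = fun k => \sum_b (\sum_a
     cQ s a * f ((compound j A ^+ k) a b / rho ^+ k)) * cQi b s); last first.
    apply/funext => k; rewrite exprMn mu_k mxE mulr_suml; apply: eq_bigr => b _.
    rewrite mulrAC mxE; congr (_ * _); rewrite mulr_suml; apply: eq_bigr => a _.
    by rewrite !mxE rmorphM fmorphV rmorphXn exprVn mulrA.
  rewrite /l mxE; apply: cvg_big => [|b _]; first by apply: add_continuous.
  apply: cvgMl; rewrite mxE; apply: cvg_big => [|a _]; first by apply: add_continuous.
  by apply: cvgMr; rewrite mxE; apply: (cvg_rmorph f_norm f_pos f_lt); exact: LP.
have [||s mus mut] := @cvg_powers_sum1 C _ (fun s => mu s / f rho) l.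
- exact: mul.
- by rewrite -[LHS]/(\tr _) mxtrace_mulC mulmxA QiQ mul1mx trace_map_mx trL rmorph1.
exists s => [|t /mut]; first by rewrite -[LHS]/(mu s) -[LHS](divfK (lt0r_neq0 frho0)) mus mul1r.
by rewrite normrM normfV (gtr0_norm frho0) ltr_pdivrMr // mul1r.
Qed.

End DominantProduct.

Lemma char_poly_similar (F : fieldType) n (A T Q : 'M[F]_n) :
  Q \in unitmx -> Q *m A = T *m Q -> char_poly A = char_poly T.
Proof.
move=> Qu QA; pose Qp := map_mx polyC Q.
have detQp : \det Qp != 0.
  by rewrite /Qp det_map_mx polyC_eq0 -unitfE -unitmxE.
apply: (mulfI detQp); rewrite [RHS]mulrC -!det_mulmx; congr (\det _).
rewrite /char_poly_mx mulmxBr mulmxBl -!map_mxM QA; congr (_ - _).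
by rewrite scalar_mxC.
Qed.

(** * Permutations and order of multi-indices *)

Section MultiIndex.

(** By [perm_index_image], [g] is an increasing family composed with a permutation, which
    commutative products do not see. *)
Lemma exists_multi_index n j (g : 'I_j -> 'I_n) : injective g ->
  exists s : 'I_('C(n, j)), multi_index s =i codom g /\
    forall (C : comNzRingType) (F : 'I_n -> C),
      \prod_i F (tnth (multi_index s) i) = \prod_i F (g i).
Proof.
move=> ginj; have : [ffun i => g i] \in [set perm_index p | p : 'I_('C(n, j)) * 'S_j]%SET.
  by rewrite perm_index_image inE; apply/injectiveP => a b; rewrite !ffunE => /ginj.
case/imsetP => -[s u] _ /ffunP gE.
have gsu i : g i = tnth (multi_index s) (u i) by have := gE i; rewrite !ffunE.
exists s; split=> [x|C F].
  apply/tnthP/codomP => -[i ->]; last by exists (u i).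
  by exists (u^-1 i)%g; rewrite gsu permKV.
rewrite (reindex_inj (@perm_inj _ u)) /=.
by apply: eq_bigr => i _; rewrite gsu.
Qed.

(** Passes from the order of eigenvalues on a triangular diagonal to a numbering by modulus. *)
Lemma multi_index_perm n j (p : 'S_n) :
  exists2 phi : 'I_('C(n, j)) -> 'I_('C(n, j)), bijective phi &
    forall s (C : comNzRingType) (F : 'I_n -> C),
      \prod_i F (tnth (multi_index (phi s)) i) = \prod_i F (p (tnth (multi_index s) i)).
Proof.
have ex s := @exists_multi_index n j (fun i => p (tnth (multi_index s) i))
  (inj_comp perm_inj (@tnth_multi_index_inj n j s)).
have [phi phiP] := choice ex.
exists phi => [|s C F]; last by case: (phiP s).
apply: injF_bij => s t st; apply: multi_index_eq_mem => x.
have mem r : (x \in multi_index r) = (p x \in multi_index (phi r)).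
  have [-> _] := phiP r; apply/tnthP/codomP => -[i xi]; exists i; first by rewrite xi.
  exact: perm_inj xi.
by rewrite !mem st.
Qed.

(** The initial segment is the termwise smallest multi-index, hence gives the product of largest
    modulus in a non-increasing numbering. *)
Lemma multi_index_ge n j (s : 'I_('C(n, j))) (i : 'I_j) : (i <= tnth (multi_index s) i)%N.
Proof.
have /(sorted_ltn_nth ltn_trans 0%N) lt_s := multi_index_sorted s.
have H k : (k < j)%N -> (k <= nth 0 [seq val x | x <- multi_index s] k)%N.
  elim: k => // k IH kj; apply: leq_ltn_trans (IH (ltnW kj)) _.
  by apply: lt_s; rewrite ?inE ?size_map ?size_tuple ?ltnS // ltnW.
have := H i (ltn_ord i); rewrite (nth_map (tnth (multi_index s) i)) ?size_tuple //.
by rewrite -tnth_nth.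
Qed.

End MultiIndex.

Lemma numbering_le (R : realType) n (A : 'M[R]_n) (lam : n.-tuple R[i]) a b :
  eigenvalue_numbering A lam -> (a <= b < n)%N -> cmod lam`_b <= cmod lam`_a.
Proof.
case=> _ lam_sorted /andP[ab bn].
apply: (sorted_leq_nth (leT := fun z w : R[i] => cmod w <= cmod z)) => //.
- by move=> y x z xy yz; exact: le_trans yz xy.
- by rewrite inE size_tuple (leq_ltn_trans ab).
- by rewrite inE size_tuple.
Qed.

(** * The spectrum of a generalized odd oscillatory operator *)

Section Spectrum.
Variables (R : realType) (n : nat) (A : 'M[R]_n).
Hypotheses (n_gt0 : (0 < n)%N) (A_osc : generalized_odd_oscillatory A).

Lemma cmodE (z : R[i]) : `|z| = real_complex R (cmod z).
Proof. by []. Qed.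

Lemma cmodM (z w : R[i]) : cmod (z * w) = cmod z * cmod w.
Proof. exact: Normc.normcM. Qed.

Lemma cmod_real (x : R) : cmod (real_complex R x) = `|x|.
Proof. by rewrite /cmod /= expr0n /= addr0 sqrtr_sqr. Qed.

(** Schur triangularization. The determinant clause serves the last eigenvalue when [n] is even. *)
Lemma exists_trig : exists T : 'M[R[i]]_n, [/\ is_trig_mx T,
  char_poly (complexify A) = \prod_(i < n) ('X - (T i i)%:P),
  \prod_(i < n) T i i = real_complex R (\det A) &
  forall j, odd j -> (j <= n)%N -> exists2 rho : R, 0 < rho &
    exists2 s : 'I_('C(n, j)),
    \prod_(i < j) T (tnth (multi_index s) i) (tnth (multi_index s) i) = real_complex R rho &
    forall t, t != s ->
      cmod (\prod_(i < j) T (tnth (multi_index t) i) (tnth (multi_index t) i)) < rho].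
Proof.
have [Q /unitarymx_unit Qu QT] := Schur (complexify A) n_gt0.
set T := conjmx Q (complexify A) in QT.
have QA : Q *m complexify A = T *m Q by apply/similarP => //; rewrite /similar_to inE.
exists T; split => //.
- by rewrite (char_poly_similar Qu QA) char_poly_trig.
- rewrite -det_trig // -det_map_mx.
  apply: (mulIf (x := \det Q)); first by rewrite -unitfE -unitmxE.
  by rewrite -!det_mulmx -QA !det_mulmx mulrC.
move=> j oj jn; have [|K [Kp Bp]] := A_osc oj; first by rewrite jn odd_gt0.
have [|||rho rho0 [s sE tE]] := @dominant_product R R[i] (real_complex R) _ _ _ n j A Q T K jn Kp Bp Qu QT QA.
- by move=> x; rewrite cmodE cmod_real.
- by case=> a b; rewrite ltcE /= => /andP[/eqP -> a0]; exists a.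
- by move=> x y; exact: ltcR.
by exists rho => //; exists s => // t /tE; rewrite cmodE ltcR.
Qed.

(** Entries of [lam] are counted from 0, so the inequality compares lambda_{j+1} with lambda_j. *)
Lemma spectral_prefix (lam : n.-tuple R[i]) j : eigenvalue_numbering A lam ->
  odd j -> (j <= n)%N ->
  exists2 rho : R, 0 < rho & \prod_(i < j) lam`_i = real_complex R rho /\
    ((j < n)%N -> cmod lam`_j < cmod lam`_j.-1).
Proof.
move=> lamP oj jn; have [chiE _] := lamP.
have [T [_ chiT _ /(_ j oj jn)[rho rho0 [s sE tE]]]] := exists_trig.
have /tuple_permP[p pE] : perm_eq lam [tuple T i i | i < n].
  by apply: prod_XsubC_eq; rewrite -chiE chiT big_tuple; apply: eq_bigr => i _; rewrite tnth_mktuple.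
have lamE (i : 'I_n) : lam`_i = T (p i) (p i).
  by rewrite -tnth_nth (val_inj pE) !tnth_mktuple.
have [phi [psi phiK psiK] phiE] := @multi_index_perm n j p.
pose mu (s : 'I_('C(n, j))) := \prod_(i < j) lam`_(tnth (multi_index s) i).
have muE t : mu t = \prod_(i < j) T (tnth (multi_index (phi t)) i) (tnth (multi_index (phi t)) i).
  by rewrite (phiE _ _ (fun i => T i i)); apply: eq_bigr => i _; rewrite lamE.
have mu_s : mu (psi s) = real_complex R rho by rewrite muE psiK.
have mu_t t : t != psi s -> cmod (mu t) < rho.
  by move=> ts; rewrite muE; apply: tE; apply: contra_neq ts => <-; rewrite phiK.
have winj : injective (widen_ord jn) by move=> a b /(congr1 val) /= ab; apply: val_inj.
have [r0 [r0mem r0E]] := exists_multi_index winj.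
have mu_r0 : mu r0 = \prod_(i < j) lam`_i by rewrite /mu (r0E _ (fun i : 'I_n => lam`_i)).
have mu_le t : `|mu t| <= `|mu r0|.
  rewrite mu_r0 !normr_prod; apply: ler_prod => i _; rewrite normr_ge0 !cmodE lecR.
  by apply: (numbering_le lamP); rewrite multi_index_ge ltn_ord.
(* Only [psi s] has a product of modulus [rho], and no product exceeds that of [r0] in modulus. *)
have r0s : r0 = psi s.
  apply/eqP; apply: contraT => /mu_t; rewrite -ltcR -cmodE -mu_s => /(le_lt_trans (mu_le (psi s))).
  by rewrite {2}mu_s cmodE mu_s cmod_real gtr0_norm // ltxx.
have lam_rho : \prod_(i < j) lam`_i = real_complex R rho by rewrite -mu_r0 r0s.
exists rho => //; split => // jn'.
have j0 : (0 < j)%N by rewrite odd_gt0.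
(* g enumerates lambda_1, ..., lambda_{j-1}, lambda_{j+1}. *)
pose g (i : 'I_j) : 'I_n := if i == j.-1 :> nat then Ordinal jn' else widen_ord jn i.
have ginj : injective g.
  move=> a b; rewrite /g; case: eqP => aj; case: eqP => bj /(congr1 val) /= ab; apply: val_inj => //=.
  - by rewrite aj bj.
  - by move: (ltn_ord b); rewrite -ab ltnn.
  - by move: (ltn_ord a); rewrite ab ltnn.
have [r1 [r1mem r1E]] := exists_multi_index ginj.
have r10 : r1 != psi s.
  rewrite -r0s; apply/eqP => r10; have := r1mem (Ordinal jn'); rewrite r10 r0mem.
  have -> : Ordinal jn' \in codom g.
    have jj : (j.-1 < j)%N by rewrite prednK.
    by apply/codomP; exists (Ordinal jj); rewrite /g /= eqxx.
  by move/codomP => -[i /(congr1 val)/= ij]; move: (ltn_ord i); rewrite -ij ltnn.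
have := mu_t _ r10; rewrite -[rho]gtr0_norm // -cmod_real -lam_rho.
rewrite /mu (r1E _ (fun i : 'I_n => lam`_i)) /g.
(* This allows cancelling the j - 1 common factors of the two products. *)
have lam_neq0 : \prod_(i < j) lam`_i != 0 by rewrite lam_rho fmorph_eq0 gt_eqF.
move: lam_neq0; case: (j) (jn) (jn') j0 => // k kn0 kn _.
rewrite !big_ord_recr /= eqxx mulf_eq0 negb_or => /andP[P0 _].
rewrite (eq_bigr (fun i : 'I_k => lam`_i)); last by move=> i _; rewrite /= ltn_eqF.
by rewrite !cmodM ltr_pM2l // -ltcR -cmodE normr_gt0.
Qed.

End Spectrum.

(** [w] is a positive multiple of the conjugate of [z]: both have the same ratio of real part to
    modulus, and imaginary parts of opposite sign. *)
Lemma arg_of_mul_gt0 (R : realType) (z w : R[i]) (t : R) : 0 < t ->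
  z * w = real_complex R t -> [/\ z != 0, w != 0 & eq_mod_2pi (arg w) (- arg z)].
Proof.
move=> t0 zw.
have zw0 : z * w != 0 by rewrite zw fmorph_eq0 gt_eqF.
have /norP[z0 w0] : ~~ ((z == 0) || (w == 0)) by rewrite -mulf_eq0.
split => //.
case: z w zw z0 w0 {zw0} => a b [c d] [reE imE] z0 w0.
have N_gt0 : 0 < a ^+ 2 + b ^+ 2.
  rewrite lt_neqAle addr_ge0 ?sqr_ge0 // andbT eq_sym paddr_eq0 ?sqr_ge0 //.
  by rewrite !sqrf_eq0; apply: contra z0 => /andP[/eqP -> /eqP ->].
set N := a ^+ 2 + b ^+ 2 in N_gt0.
have N0 : N != 0 by rewrite gt_eqF.
pose k := t / N.
have k0 : 0 < k by rewrite divr_gt0.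
have cE : c = k * a.
  apply: (mulfI N0); rewrite mulrA (mulrC N k) divfK // -reE /N; apply/subr0_eq.
  by rewrite -[RHS](mulr0 b) -imE; ring.
have dE : d = - (k * b).
  apply: (mulfI N0); rewrite mulrN mulrA (mulrC N k) divfK // -reE /N; apply/subr0_eq.
  by rewrite -[RHS](mulr0 a) -imE; ring.
(* The bilinear relations say w = k * conj z with k > 0. *)
clearbody k.
have ratio : c / cmod (c +i* d)%C = a / cmod (a +i* b)%C.
  have -> : cmod (c +i* d)%C = k * cmod (a +i* b)%C.
    rewrite /cmod /= cE dE sqrrN !exprMn -mulrDr sqrtrM ?sqr_ge0 //.
    by rewrite sqrtr_sqr gtr0_norm.
  by rewrite cE -mulf_div divff ?gt_eqF // mul1r.
rewrite /eq_mod_2pi /arg /= ratio dE oppr_ge0 pmulr_rle0 //.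
have [b0|b0|b0] := ltgtP b 0.
- by exists 0; rewrite mul0r addr0 opprK.
- by exists 0; rewrite mul0r addr0.
(* On the negative real axis both arguments are pi, whence the shift by 2 pi. *)
have a0 : a != 0 by apply: contra z0 => /eqP ->; rewrite b0.
rewrite /cmod /= b0 expr0n addr0 sqrtr_sqr.
have [a_gt0|a_lt0] := ltrP 0 a.
  by exists 0; rewrite gtr0_norm // divff // acos1 mul0r addr0 oppr0.
exists 1; rewrite ltr0_norm ?lt_neqAle ?a0 // invrN mulrN divff // acosN1.
by ring.
Qed.

(** * Moduli, multiplicities and arguments along a numbering *)

Section Numbering.
Variables (R : realType) (n : nat) (A : 'M[R]_n) (lam : n.-tuple R[i]).
Hypotheses (n_gt0 : (0 < n)%N) (A_osc : generalized_odd_oscillatory A).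
Hypothesis lamP : eigenvalue_numbering A lam.

Lemma numbering_lt i : ~~ odd i -> (i.+1 < n)%N -> cmod lam`_i.+1 < cmod lam`_i.
Proof.
move=> oi ni; have [rho _ [_]] := spectral_prefix n_gt0 A_osc lamP (j := i.+1) oi (ltnW ni).
exact.
Qed.

(** The modulus drops strictly after every even position, so [a, b) contains no even number. *)
Lemma numbering_cmod_eq a b : (a < b < n)%N -> cmod lam`_a = cmod lam`_b ->
  odd a /\ b = a.+1.
Proof.
case/andP => ab bn cab.
have even_lt c : (a <= c < b)%N -> odd c.
  case/andP => ac cb; apply: contraT => oc.
  have := numbering_lt oc (leq_ltn_trans cb bn); rewrite ltNge => /negP[].
  apply: (@le_trans _ _ (cmod lam`_a)); first by rewrite (numbering_le lamP) // ac (ltn_trans cb).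
  by rewrite cab (numbering_le lamP) // cb bn.
have oa : odd a by apply: even_lt; rewrite leqnn.
split => //; apply/eqP; rewrite eqn_leq ab andbT leqNgt; apply/negP => ab2.
by have := even_lt a.+1; rewrite leqnSn ab2 /= oa => /(_ isT).
Qed.

Lemma alg_multE z : alg_mult A z = #|[pred i : 'I_n | lam`_i == z]|.
Proof.
case: lamP => chiE _; rewrite /alg_mult chiE mu_prod_XsubC.
rewrite -sum1_count big_tuple -sum1_card; apply: eq_bigl => i.
by rewrite inE (tnth_nth 0).
Qed.

(** Three positions with the same eigenvalue would be pairwise consecutive. *)
Lemma alg_mult_le2 z : (alg_mult A z <= 2)%N.
Proof.
rewrite alg_multE leqNgt; apply/negP => /card_gt2P[a [b [c [[]]]]].
rewrite !inE => /eqP az /eqP bz /eqP cz [ab bc ca].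
have adj (x y : 'I_n) : lam`_x = z -> lam`_y = z -> x != y -> y = x.+1 :> nat \/ x = y.+1 :> nat.
  move=> xz yz; rewrite neq_ltn => /orP[] xy; [left|right].
    by case: (@numbering_cmod_eq x y); rewrite ?xy ?ltn_ord ?xz ?yz.
  by case: (@numbering_cmod_eq y x); rewrite ?xy ?ltn_ord ?xz ?yz.
have := adj _ _ az bz ab; have := adj _ _ bz cz bc; have := adj _ _ cz az ca.
lia.
Qed.

Lemma numbering0 : exists2 rho : R, 0 < rho & lam`_0 = real_complex R rho.
Proof.
have [rho rho0 []] := spectral_prefix n_gt0 A_osc lamP (j := 1) isT n_gt0.
by rewrite big_ord1 => E _; exists rho.
Qed.

Lemma spectral_radiusE : spectral_radius A = cmod lam`_0.
Proof.
case: lamP => chiE _.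
have eigE z : eigenvalue (complexify A) z = (z \in lam).
  by rewrite eigenvalue_root_char chiE root_prod_XsubC.
apply/eqP; rewrite eq_le; apply/andP; split.
  apply: ge_sup; first by exists (cmod lam`_0), lam`_0 => //=; rewrite eigE mem_nth ?size_tuple.
  move=> y [z /=]; rewrite eigE => /tnthP[i ->] <-.
  by rewrite (tnth_nth 0) (numbering_le lamP) /=.
apply: ub_le_sup.
  exists (cmod lam`_0) => y [z /=]; rewrite eigE => /tnthP[i ->] <-.
  by rewrite (tnth_nth 0) (numbering_le lamP) /=.
by exists lam`_0 => //=; rewrite eigE mem_nth ?size_tuple.
Qed.

Lemma alg_mult_lead : alg_mult A lam`_0 = 1%N.
Proof.
rewrite alg_multE -(card1 (Ordinal n_gt0)); apply: eq_card => i; rewrite !inE.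
apply/eqP/eqP => [i0|->//]; apply: val_inj; apply/eqP; rewrite /= -leqn0 leqNgt; apply/negP => i_gt0.
by have [] := @numbering_cmod_eq 0 i _ (congr1 (@cmod R) (esym i0)); rewrite ?i_gt0 ?ltn_ord.
Qed.

(** The product of all eigenvalues is the real number det A, and that of the first n - 1 is positive
    because n - 1 is odd. *)
Lemma numbering_last_real : ~~ odd n -> complex.Im lam`_n.-1 = 0.
Proof.
move=> on; have on1 : odd n.-1 by rewrite -[odd _]negbK -oddS prednK.
have [rho rho0 [prefE _]] := spectral_prefix n_gt0 A_osc lamP on1 (leq_pred n).
have [T [_ chiT detT _]] := exists_trig n_gt0 A_osc.
have permT : perm_eq lam [tuple T i i | i < n].
  case: lamP => chiE _; apply: prod_XsubC_eq; rewrite -chiE chiT big_tuple.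
  by apply: eq_bigr => i _; rewrite tnth_mktuple.
have prodE : \prod_(i < n) lam`_i = real_complex R (\det A).
  rewrite -detT; transitivity (\prod_(z <- lam) z).
    by rewrite big_tuple; apply: eq_bigr => i _; rewrite (tnth_nth 0).
  by rewrite (perm_big _ permT) big_tuple; apply: eq_bigr => i _; rewrite tnth_mktuple.
have : real_complex R rho * lam`_n.-1 = real_complex R (\det A).
  have split_last (l : seq R[i]) : \prod_(i < n) l`_i = \prod_(i < n.-1) l`_i * l`_n.-1.
    by rewrite -[in LHS](prednK n_gt0) big_ord_recr.
  by rewrite -prefE -prodE split_last.
move=> E; have -> : lam`_n.-1 = real_complex R (\det A / rho) => //.
apply: (mulfI (x := real_complex R rho)); first by rewrite fmorph_eq0 gt_eqF.
by rewrite E -rmorphM mulrCA divff ?gt_eqF // mulr1.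
Qed.

(** The prefix products of odd lengths [i] and [i.+2] are positive, and their quotient is the
    product of the pair. *)
Lemma numbering_pair i : odd i -> (i.+1 < n)%N ->
  [/\ lam`_i != 0, lam`_i.+1 != 0 & eq_mod_2pi (arg lam`_i.+1) (- arg lam`_i)].
Proof.
move=> oi ni.
have [r r0 [rE _]] := spectral_prefix n_gt0 A_osc lamP oi (ltnW (ltnW ni)).
have oi2 : odd i.+2 by rewrite /= negbK.
have [t t0 [tE _]] := spectral_prefix n_gt0 A_osc lamP oi2 ni.
apply: (@arg_of_mul_gt0 R _ _ (t / r)); first exact: divr_gt0.
apply: (mulfI (x := real_complex R r)); first by rewrite fmorph_eq0 gt_eqF.
by rewrite -rmorphM (mulrC r) divfK ?gt_eqF // -[RHS]/(real_complex R t) -tE !big_ord_recr /= rE mulrA.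
Qed.

End Numbering.

(** Lets the multiplicity bound, stated without a numbering, be derived from one. *)
Lemma exists_numbering (R : realType) (n : nat) (A : 'M[R]_n) :
  (0 < n)%N -> generalized_odd_oscillatory A -> exists lam, eigenvalue_numbering A lam.
Proof.
move=> n0 hA; have [T [_ chiT _ _]] := exists_trig n0 hA.
pose leC (z w : R[i]) := cmod w <= cmod z.
exists (sort_tuple leC [tuple T i i | i < n]); split; last first.
  by apply: sort_sorted => z w; rewrite /leC le_total.
rewrite chiT (perm_big _ (permEl (perm_sort _ _))) big_tuple.
by apply: eq_bigr => i _; rewrite tnth_mktuple.
Qed.

Theorem theorem5 (R : realType) (n : nat) (A : 'M[R]_n) (hn : (0 < n)%N)
    (hA : generalized_odd_oscillatory A) :
  (forall z : R[i], eigenvalue (complexify A) z -> (alg_mult A z <= 2)%N) /\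
  (forall lam : n.-tuple R[i], eigenvalue_numbering A lam ->
    [/\ spectral_radius A = cmod lam`_0,
        (forall i : nat, ~~ odd i -> (i.+1 < n)%N ->
          cmod lam`_i.+1 < cmod lam`_i),
        [/\ lam`_0 = real_complex R (spectral_radius A),
            0 < spectral_radius A
          & alg_mult A lam`_0 = 1%N],
        (~~ odd n -> complex.Im lam`_n.-1 = 0)
      & (forall i : nat, odd i -> (i.+1 < n)%N ->
          [/\ lam`_i != 0, lam`_i.+1 != 0
            & eq_mod_2pi (arg lam`_i.+1) (- arg lam`_i)])]).
Proof.
split=> [z _|lam lamP].
  by have [lam lamP] := exists_numbering hn hA; exact: alg_mult_le2 hn hA lamP z.
have [rho rho0 lam0] := numbering0 hn hA lamP.
have rhoE : spectral_radius A = rho.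
  by rewrite (spectral_radiusE hn lamP) lam0 cmod_real gtr0_norm.
split.
- exact: spectral_radiusE.
- by move=> i oi ni; exact: numbering_lt hn hA lamP _ oi ni.
- by split; [rewrite rhoE | rewrite rhoE | exact: alg_mult_lead].
- exact: (numbering_last_real hn hA lamP).
- by move=> i oi ni; exact: numbering_pair hn hA lamP _ oi ni.
Qed.
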